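(* Consider the single-server retrial queue with event-dependent arrivals described in the context, let $X_i$ be the number of customers in orbit just after the $i$-th departure, and consider the condition $$\text{(S)}\qquad \bar b<\frac{\alpha^{*}(\lambda^{-})\,[\lambda_{+}^{r}+(\lambda^{r}-\lambda_{+}^{r})\beta^{*}(\lambda^{r})]}{\lambda^{r}[\lambda_{+}^{e}+(\lambda_{+}^{r}-\lambda_{+}^{e})\alpha^{*}(\lambda^{-})]}-\frac{(1-\alpha^{*}(\lambda^{-}))(\lambda^{e}-\lambda_{+}^{e})(1-\beta^{*}(\lambda^{e}))}{\lambda^{e}[\lambda_{+}^{e}+(\lambda_{+}^{r}-\lambda_{+}^{e})\alpha^{*}(\lambda^{-})]}.$$ Under (S), the stationary distribution $(\pi_n)_{n\ge0}$ of $\{X_i\}$ has probability generating function $\Pi(z)=\sum_{n\ge0}\pi_nz^n$, $|z|\le1$, given by $$\Pi(z)=\pi_{0}\,\alpha^{*}(\lambda^{-})\,\frac{zA_{e}(z)-A_{r}(z)}{\alpha^{*}(\lambda^{-})(zA_{e}(z)-A_{r}(z))+z(1-A_{e}(z))},$$ where $$\pi_{0}=\frac{\lambda^{e}\alpha^{*}(\lambda^{-})\,[\lambda_{+}^{r}(1-\lambda^{r}\bar b)+\beta^{*}(\lambda^{r})(\lambda^{r}-\lambda_{+}^{r})]-\lambda^{r}(1-\alpha^{*}(\lambda^{-}))\,[\lambda_{+}^{e}\lambda^{e}\bar b+(1-\beta^{*}(\lambda^{e}))(\lambda^{e}-\lambda_{+}^{e})]}{\alpha^{*}(\lambda^{-})\left(\lambda^{e}[\lambda_{+}^{r}(1-\lambda^{r}\bar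 b)+\beta^{*}(\lambda^{r})(\lambda^{r}-\lambda_{+}^{r})]+\lambda^{r}[\lambda_{+}^{e}\lambda^{e}\bar b+(1-\beta^{*}(\lambda^{e}))(\lambda^{e}-\lambda_{+}^{e})]\right)}.$$ Moreover (from the requirement $\pi_0>0$), condition (S) is also necessary for the ergodicity of the chain $\{X_i\}$.
   Context: Model. A single server with no waiting room and an infinite-capacity orbit. Service times are i.i.d. with density $b(\cdot)$, Laplace-Stieltjes transform (LST) $\beta^{*}(s)=\int_0^\infty e^{-st}b(t)\,dt$ and finite mean $\bar b$. A customer arriving at a busy server joins the orbit. After each service completion the customer leaves and, if the orbit is nonempty, the server starts seeking a customer from the orbit; seeking times are i.i.d. with density $a(\cdot)$ and LST $\alpha^{*}(s)=\int_0^\infty e^{-st}a(t)\,dt$. If an external (primary) customer arrives during seeking, the seeking is cancelled and the arriving customer is served; otherwise at the end of the seeking time one orbiting (retrial) customer leaves the orbit and starts service. If the orbit is empty, the server waits for an external arrival. Interarrival, service and seeking times are mutually independent. Event-dependent arrival rates (all positive): while the server is idle (the last event was a service completion), external customers arrive at rate $\lambda^{-}$. During a service of an external customer (type $e$) the first arrival occurs at rate $\lambda^{e}$ and all subsequent arrivals during that service at rate $\lambda_{+}^{e}$. During a service of a retrial customer (type $r$) the first arrival occurs at rate $\lambda^{r}$ and all subsequent arrivals during that service at rate $\lambda_{+}^{r}$. For $k\in\{e,r\}$ let $b_n^{k}$ be the probability that exactly $n$ customers arrive during a service of a type-$k$ customer, i.e. $b_n^k=\int_0^\infty \mathbb P_k(N(t)=n)b(t)\,dt$,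 where under $\mathbb P_k$ the process $N$ is the pure birth process started at $0$ with birth rate $\lambda^k$ in state $0$ and $\lambda_+^k$ in every state $n\ge1$, and let $$A_k(z)=\sum_{n\ge0}b_n^kz^n=\frac{\beta^{*}(\lambda^{k})(\lambda_{+}^{k}-\lambda^{k})(1-z)-\lambda^{k}z\beta^{*}(\lambda_{+}^{k}(1-z))}{\lambda_{+}^{k}(1-z)-\lambda^{k}},\qquad |z|\le1.$$ The chain $\{X_i\}$ on $\{0,1,2,\dots\}$ has transition probabilities $p_{0,n}=b_n^{e}$ ($n\ge0$), $p_{m,n}=(1-\alpha^{*}(\lambda^{-}))b_{n-m}^{e}+\alpha^{*}(\lambda^{-})b_{n-m+1}^{r}$ ($1\le m\le n$), $p_{m+1,m}=\alpha^{*}(\lambda^{-})b_0^{r}$ ($m\ge0$), and $0$ otherwise; its stationary equations are, for $n\ge0$, $\pi_n=\pi_0b_n^e+(1-\delta_{0n})(1-\alpha^{*}(\lambda^-))\sum_{j=1}^n\pi_jb_{n-j}^e+\alpha^{*}(\lambda^-)\sum_{j=1}^{n+1}\pi_jb_{n+1-j}^r$. Ratios at points where a denominator vanishes (e.g. $z=1$) are understood as limits. *)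

(* Defs.v *)
From HB Require Import structures.
From mathcomp Require Import all_boot all_order all_algebra.
From mathcomp Require Import all_classical all_reals all_analysis.
From mathcomp Require Import complex.

Set Implicit Arguments.
Unset Strict Implicit.
Unset Printing Implicit Defensive.

Import Order.TTheory GRing.Theory Num.Theory.
Import numFieldNormedType.Exports.

Local Open Scope classical_set_scope.
Local Open Scope ring_scope.
Local Open Scope complex_scope.

(* Complex numbers, typed so that the topology that MathComp-Analysis attaches
   to every numFieldType is found (it is not found on [R[i]] itself). *)
Definition Cplx (R : realType) : numClosedFieldType := R[i].

Definition is_density (R : realType) (f : R -> R) : Prop :=
  [/\ measurable_fun (`[0, +oo[ : set R) f,
      forall t, 0 <= t -> 0 <= f t
    & (\int[lebesgue_measure]_(t in `[0%R, +oo[) (f t)%:E = 1)%E].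

Definition finite_mean (R : realType) (f : R -> R) : Prop :=
  (\int[lebesgue_measure]_(t in `[0%R, +oo[) (t * f t)%:E < +oo)%E.

Definition mean (R : realType) (f : R -> R) : R :=
  \int[lebesgue_measure]_(t in `[0, +oo[) (t * f t).

(* Laplace-Stieltjes transform at a real argument *)
Definition lst (R : realType) (f : R -> R) (s : R) : R :=
  \int[lebesgue_measure]_(t in `[0, +oo[) (expR (- s * t) * f t).

Definition mutually_independent d (Omega : measurableType d) (R : realType)
    (P : probability Omega R) (T : nat -> {RV P >-> R}) : Prop :=
  forall (s : seq nat) (B : nat -> set R), uniq s ->
    (forall i, measurable (B i)) ->
    P (\bigcap_(i in [set` s]) (T i @^-1` B i)) =
    (\prod_(i <- s) P (T i @^-1` B i))%E.

Definition exponentially_distributed d (Omega : measurableType d)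
    (R : realType) (P : probability Omega R) (r : R) (X : {RV P >-> R}) : Prop :=
  forall B : set R, measurable B -> distribution P X B = exponential_prob r B.

(* [T n] is the holding time in state [n], so that the process has made at
   least [n] jumps by time [t] iff [T 0 + ... + T n.-1 <= t]. *)
Definition pure_birth d (Omega : measurableType d) (R : realType)
    (P : probability Omega R) (rate : nat -> R)
    (N : R -> {mfun Omega >-> nat}) : Prop :=
  exists T : nat -> {RV P >-> R},
    [/\ mutually_independent T,
        forall n, exponentially_distributed (rate n) (T n)
      & {ae P, forall w, forall (t : R) (n : nat), 0 <= t ->
           (n <= N t w)%N = (\sum_(i < n) T i w <= t)}].

Definition first_then (R : realType) (r rp : R) (n : nat) : R :=
  if n == 0%N then r else rp.

(* Law of the number of arrivals during a service time with density [b] that is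
   independent of the arrival process [N]. *)
Definition arrivals_during d (Omega : measurableType d) (R : realType)
    (P : probability Omega R) (N : R -> {mfun Omega >-> nat}) (b : R -> R)
    (n : nat) : R :=
  \int[lebesgue_measure]_(t in `[0, +oo[)
     (fine (P [set w | N t w = n]) * b t).

Definition pgf (R : realType) (p : nat -> R) (z : Cplx R) : Cplx R :=
  lim (series (fun n => (p n)%:C * z ^+ n : Cplx R) @ \oo).

Definition unit_disc (R : realType) : set (Cplx R) :=
  [set w | `|w| <= 1].

(* [v] is the value at [z] of the ratio [f / g] of functions on the closed unit
   disc, read as a limit within the disc when [g z = 0]. *)
Definition ratio_value (R : realType) (f g : Cplx R -> Cplx R)
    (z v : Cplx R) : Prop :=
  if g z == 0 then
    (\forall w \near within (@unit_disc R) z^', g w != 0) /\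
    (fun w => f w / g w) @ within (@unit_disc R) z^' --> v
  else v = f z / g z.

Definition stationary_distribution (R : realType) (p : nat -> nat -> R)
    (pi : nat -> R) : Prop :=
  [/\ forall n, 0 <= pi n,
      (\sum_(0 <= n <oo) (pi n)%:E = 1)%E
    & forall n, ((pi n)%:E = \sum_(0 <= m <oo) (pi m * p m n)%:E)%E].

Fixpoint nstep (R : realType) (p : nat -> nat -> R) (n : nat) (i j : nat)
    : \bar R :=
  if n is n'.+1 then (\sum_(0 <= k <oo) (p i k)%:E * nstep p n' k j)%E
  else ((i == j)%:R)%:E.

(* Probability that, starting from [i], the first visit to [j] at a positive
   time takes place at time [n.+1]. *)
Fixpoint first_passage (R : realType) (p : nat -> nat -> R) (n : nat)
    (i j : nat) : \bar R :=
  if n is n'.+1 then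
    (\sum_(0 <= k <oo | k != j) (p i k)%:E * first_passage p n' k j)%E
  else (p i j)%:E.

Definition irreducible (R : realType) (p : nat -> nat -> R) : Prop :=
  forall i j, exists n, (0 < nstep p n i j)%E.

Definition aperiodic (R : realType) (p : nat -> nat -> R) : Prop :=
  forall i d, (forall n, (0 < n)%N -> (0 < nstep p n i i)%E -> (d %| n)%N) ->
    d = 1%N.

Definition positive_recurrent (R : realType) (p : nat -> nat -> R) : Prop :=
  forall i, (\sum_(0 <= n <oo) first_passage p n i i = 1)%E /\
    (\sum_(0 <= n <oo) (n.+1%:R)%:E * first_passage p n i i < +oo)%E.

Definition ergodic (R : realType) (p : nat -> nat -> R) : Prop :=
  [/\ irreducible p, aperiodic p & positive_recurrent p].

Definition orbit_chain (R : realType) (alpha : R) (be br : nat -> R)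
    (m n : nat) : R :=
  if m == 0%N then be n
  else if (m <= n)%N then
    (1 - alpha) * be (n - m)%N + alpha * br (n - m).+1
  else if m == n.+1 then alpha * br 0%N
  else 0.

(* Main.v *)
(* Write A_e(z) - 1 = (z - 1) S(z) and alpha A_r(z) + (1 - alpha) z A_e(z) - 1
   = (z - 1) C(z), where the coefficients of S and C are tail probabilities.
   Equating the flows up and down across each level turns the stationary
   equations into the convolution equation v = pi_0 s + v * c for
   v_n = pi_(n+1). Hence V(z) (1 - C(z)) = pi_0 S(z), which is the formula for
   Pi(z) = pi_0 + z V(z). At z = 1 it gives (1 - C(1)) (1 - pi_0) = pi_0 S(1),
   hence the value of pi_0. Condition (S) is exactly C(1) < 1: it makes the
   convolution equation summable, and since |C| <= C(1) on the disc it leaves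
   z = 1 as the only zero of the denominator.
   Conversely the expected numbers of visits to each state during an excursion
   from 0 form, after normalization, a stationary distribution of a positive
   recurrent chain, and the same identity at z = 1 forces C(1) < 1.
   The mean number of arrivals comes from the exponential identity
   E (c - T)^+ = c^+ - P(T <= c) / r: applied to T = T_n and c = t - S_n, where
   S_n is the sum of the first n holding times, it makes
   P(S_(n+1) <= t) = r_n (E (t - S_n)^+ - E (t - S_(n+1))^+) telescope. *)
Require Import Defs.
From HB Require Import structures.
From mathcomp Require Import all_boot all_order all_algebra.
From mathcomp Require Import all_classical all_reals all_analysis.
From mathcomp Require Import complex.
From mathcomp Require Import measurable_realfun ring lra.

Set Implicit Arguments.
Unset Strict Implicit.
Unset Printing Implicit Defensive.

Import Order.TTheory GRing.Theory Num.Theory.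
Import numFieldNormedType.Exports.

Local Open Scope classical_set_scope.
Local Open Scope ring_scope.
Local Open Scope complex_scope.

(** * Sequences and series *)

Lemma cvg0_le_norm (K : numFieldType) (u w : nat -> K) :
  (forall n, `|u n| <= w n) -> w @ \oo --> (0 : K) -> u @ \oo --> (0 : K).
Proof.
move=> uw /cvgrPdist_lt w0; apply/cvgrPdist_lt => e e0.
have := w0 e e0; apply: filterS => n; rewrite !sub0r !normrN.
by apply: le_lt_trans; rewrite (le_trans (uw n)) ?ler_norm// real_ler_norm//
  ger0_real// (le_trans _ (uw n)).
Qed.

(** The products [a i * b j] with [i + j < n] fill a triangle, summed by antidiagonals on the left
    and by rows on the right. *)
Lemma series_convE (K : pzRingType) (a b : nat -> K) n :
  \sum_(0 <= m < n) \sum_(i < m.+1) a i * b (m - i)%N =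
  \sum_(i < n) a i * \sum_(0 <= j < n - i) b j.
Proof.
elim: n => [|n IH]; first by rewrite big_geq// big_ord0.
rewrite big_nat_recr//= IH [in RHS]big_ord_recr/= [X in _ + X]big_ord_recr/=.
rewrite addrA -big_split/= subnn subSnn big_nat1; congr (_ + _).
by apply: eq_bigr => i _; rewrite subSn ?(ltnW (ltn_ord i))// big_nat_recr//= mulrDr.
Qed.

(** Cauchy product of absolutely convergent series. The product of the partial sums exceeds the
    partial sum of the convolution by [\sum_(i < n) a i * (series b n - series b (n - i))], which is
    shown to vanish in the limit. *)
Lemma cvg_series_conv (K : numFieldType) (a b : nat -> K) (A B : K) :
  cvgn (series (fun n => `|a n| : K)) -> cvgn (series (fun n => `|b n| : K)) ->
  series a @ \oo --> A -> series b @ \oo --> B ->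
  series (fun n => \sum_(i < n.+1) a i * b (n - i)%N) @ \oo --> A * B.
Proof.
move=> cA cB aA bB.
pose A' : nat -> K := series (fun n => `|a n|);
  pose B' : nat -> K := series (fun n => `|b n|).
rewrite -/A' -/B' in cA cB.
(* The defect is cut at [i = n./2]. Below the cut the block of [b] starts no earlier than
   [n - n./2]; from the cut on, [a] contributes only a tail. *)
pose w (n : nat) : K := A' n * (B' n - B' (n - n./2)%N) + (A' n - A' n./2) * B' n.
have wE n : `|series a n * series b n -
    series (fun n => \sum_(i < n.+1) a i * b (n - i)%N) n| <= w n.
  rewrite {3}/series/= series_convE {1}/series/= big_mkord mulr_suml -sumrB.
  apply: (le_trans (ler_norm_sum _ _ _)).
  have B'_sub m : (m <= n)%N -> `|series b n - series b m| <= B' n - B' m.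
    by move=> mn; rewrite /B' !sub_series_geq// ler_norm_sum.
  have B'0 m : 0 <= B' m by apply: sumr_ge0.
  have B'_le p q : (p <= q)%N -> B' p <= B' q.
    by move=> pq; rewrite -subr_ge0 /B' sub_series_geq// sumr_ge0.
  have hn : (n./2 <= n)%N by rewrite -[leqRHS]odd_double_half -addnn addnA leq_addl.
  have A'_sub : A' n - A' n./2 = \sum_(n./2 <= i < n) `|a i| by exact: sub_series_geq.
  rewrite /w A'_sub.
  have -> : \sum_(i < n) `|a i * series b n - a i * \sum_(0 <= j < n - i) b j|
     = \sum_(0 <= i < n) `|a i * (series b n - series b (n - i)%N)|.
    by rewrite big_mkord; apply: eq_bigr => i _; rewrite mulrBr.
  rewrite (big_cat_nat _ hn)//= lerD//; last first.
    rewrite big_distrl/=; apply: ler_sum => i _; rewrite normrM ler_wpM2l//.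
    by rewrite (le_trans (B'_sub _ _)) ?leq_subr// lerBlDr lerDl.
  apply: (@le_trans _ _ (A' n./2 * (B' n - B' (n - n./2)%N))).
    rewrite big_distrl/= big_nat [leRHS]big_nat; apply: ler_sum => i /andP[_ ih].
    rewrite normrM ler_wpM2l// (le_trans (B'_sub _ _)) ?leq_subr//.
    by rewrite lerD2l lerN2 B'_le// leq_sub2l// ltnW.
  rewrite ler_wpM2r ?subr_ge0 ?B'_le ?leq_subr//.
  by rewrite -subr_ge0 A'_sub sumr_ge0.
have half_oo : n./2 @[n --> \oo] --> \oo.
  by apply/cvgnyPge => N; exists N.*2 => // n /= Nn; rewrite geq_half_double.
have subhalf_oo : (n - n./2)%N @[n --> \oo] --> \oo.
  apply/cvgnyPge => N; exists N.*2 => // n /= Nn.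
  have -> : (n - n./2 = odd n + n./2)%N
    by rewrite -{1}(odd_double_half n) -addnn addnA addnK.
  by rewrite (leq_trans _ (leq_addl _ _))// geq_half_double.
have cA2 : A' n./2 @[n --> \oo] --> limn A'
  by apply: (@cvg_comp _ _ _ half A' _ _ _ half_oo); exact: cA.
have cB2 : B' (n - n./2)%N @[n --> \oo] --> limn B'.
  apply: (@cvg_comp _ _ _ (fun n => n - n./2)%N B' _ _ _ subhalf_oo); exact: cB.
have w0 : w @ \oo --> (0 : K).
  have := cvgD (cvgM cA (cvgB cB cB2)) (cvgM (cvgB cA cA2) cB).
  rewrite !subrr mulr0 mul0r addr0 => h; exact: h.
have := cvg0_le_norm wE w0 => d0.
pose c : nat -> K := series (fun n => \sum_(i < n.+1) a i * b (n - i)%N).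
have cE : (fun n => series a n * series b n) - (fun n =>
  series a n * series b n - c n) = c.
  by apply/funext => n; rewrite !fctE opprB addrC subrK.
have : c @ \oo --> A * B by rewrite -cE -[A * B]subr0; exact: cvgB (cvgM aA bB) d0.
exact.
Qed.

Lemma eq_cvg_seq (K : numFieldType) (u v : nat -> K) (l : K) :
  u =1 v -> u @ \oo --> l -> v @ \oo --> l.
Proof. by move=> /funext ->. Qed.

Lemma continuous_exprn (K : numFieldType) (n : nat) : continuous (fun w : K => w ^+ n).
Proof.
elim: n => [|n IH] z; first exact: cst_continuous.
have -> : (fun w : K => w ^+ n.+1) = idfun \* (fun w => w ^+ n).
  by apply/funext => w; rewrite exprS.
by apply: continuousM; [exact: cvg_id|exact: IH].
Qed.

Lemma continuous_series_monomials (K : numFieldType) (c : nat -> K) (N : nat) :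
  continuous (fun w : K => series (fun n => c n * w ^+ n) N).
Proof.
rewrite /series/=; elim: N => [|N IH] z.
  by under eq_fun do rewrite big_geq//; exact: cst_continuous.
have -> : (fun w => \sum_(0 <= n < N.+1) c n * w ^+ n) =
    (fun w => \sum_(0 <= n < N) c n * w ^+ n) \+ (fun w => c N * w ^+ N).
  by apply/funext => w; rewrite big_nat_recr.
apply: continuousD; first exact: IH.
by apply: continuousM; [exact: cst_continuous|exact: continuous_exprn].
Qed.

Section real_series.
Variable R : realType.

Lemma nonneg_series_le (u : nat -> R) (s : R) n :
  (forall n, 0 <= u n) -> series u @ \oo --> s -> series u n <= s.
Proof.
move=> u0 us; rewrite -(cvg_lim (@Rhausdorff R) us).
apply: nondecreasing_cvgn_le; last by apply/cvg_ex; exists s.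
exact: nondecreasing_series (fun n _ _ => u0 n).
Qed.

Lemma nneseries_limn (u : nat -> R) : cvgn (series u) ->
  (\sum_(0 <= n <oo) (u n)%:E = (limn (series u))%:E)%E.
Proof.
move=> cu; rewrite -EFin_lim//; congr (limn _); apply/funext => n /=.
by rewrite /series/= sumEFin.
Qed.

Lemma nneseries_cvg (u : nat -> R) (s : R) : (forall n, 0 <= u n) ->
  (\sum_(0 <= n <oo) (u n)%:E = s%:E)%E -> series u @ \oo --> s.
Proof.
move=> u0 us; have cu : cvgn (series u) by apply: nnseries_is_cvg => //;
  rewrite us ltry.
by move: us; rewrite nneseries_limn// => -[<-].
Qed.

Lemma nneseries_finite (u : nat -> R) N : (forall n, 0 <= u n) ->
  (forall n, (N <= n)%N -> u n = 0) ->
  (\sum_(0 <= n <oo) (u n)%:E = (\sum_(n < N) u n)%:E)%E.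
Proof.
move=> u0 uN; rewrite (nneseries_split 0 N) => [|k _]; last by rewrite lee_fin.
by rewrite eseries0 => [|n nN _]; rewrite ?uN// adde0 add0n big_mkord sumEFin.
Qed.

Lemma series_shift_cvg (u : nat -> R) (s : R) :
  series u @ \oo --> s -> series (fun n => u n.+1) @ \oo --> s - u 0%N.
Proof.
rewrite -cvg_shiftS/= => h.
have : (fun n => series u n.+1 - u 0%N) @ \oo --> s - u 0%N.
  by apply: cvgB => //; exact: cvg_cst.
by apply: eq_cvg_seq => n; rewrite /series/= big_nat_recl// addrAC subrr add0r.
Qed.

End real_series.

Fixpoint rec_table (T : Type) (f : nat -> (nat -> T) -> T) (x0 : T) n : seq T :=
  if n is m.+1 then rcons (rec_table f x0 m) (f m (nth x0 (rec_table f x0 m))) else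
    [::].

(** [f n] reads its argument only below [n], so the finite tables of values fit together into one
    sequence. This serves to solve the level equation, whose right side involves all earlier
    terms. *)
Lemma strong_recursion (T : Type) (f : nat -> (nat -> T) -> T) (x0 : T) :
  (forall n u v, (forall i, (i < n)%N -> u i = v i) -> f n u = f n v) ->
  exists u : nat -> T, forall n, u n = f n u.
Proof.
move=> ext; pose tb := rec_table f x0; pose u n := nth x0 (tb n.+1) n.
have tb_size n : size (tb n) = n by elim: n => //= n IH; rewrite size_rcons IH.
have tbE n i : (i < n)%N -> nth x0 (tb n) i = u i.
  elim: n => // n IH; rewrite ltnS leq_eqVlt => /predU1P[->//|ni].
  by rewrite -IH// [tb n.+1]/= nth_rcons tb_size ni.
exists u => n; rewrite /u [tb n.+1]/= nth_rcons tb_size ltnn eqxx.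
by apply: ext => i; exact: tbE.
Qed.

(** * Generating functions on the closed unit disc *)

Section cplx_lemmas.
Variable R : realType.
Implicit Types (q : nat -> R) (z w : Cplx R).

(** The order on [Cplx R] compares only numbers with equal imaginary parts, so every epsilon of a
    limit argument is a positive real. *)
Lemma cplx_gt0E (e : Cplx R) : 0 < e -> e = (complex.Re e)%:C /\ 0 < complex.Re e.
Proof. by case: e => x y; rewrite ltcE/= => /andP[/eqP -> ->]. Qed.

Lemma cplx_normE (z : Cplx R) : `|z| = (ComplexField.Normc.normc z)%:C.
Proof. by []. Qed.

Lemma cvg_real_complex (u : nat -> R) (l : R) :
  u @ \oo --> l -> ((u n)%:C : Cplx R) @[n --> \oo] --> (l%:C : Cplx R).
Proof.
move=> /cvgrPdist_lt ul; apply/cvgrPdist_lt => e /cplx_gt0E[-> e0].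
have := ul _ e0; apply: filterS => n.
by rewrite -(raddfB (real_complex R)) normc_def/= expr0n/= addr0 sqrtr_sqr ltcR.
Qed.

Lemma cplx_lim_norm_le (u : nat -> Cplx R) (l : Cplx R) (M : R) (N : nat) :
  u @ \oo --> l -> (forall n, (N <= n)%N -> `|u n| <= M%:C) -> `|l| <= M%:C.
Proof.
move=> /cvgrPdist_le ul uM; rewrite cplx_normE lecR; apply/ler_addgt0Pr => e e0.
have [|K _ /(_ (maxn K N))/(_ (leq_maxl _ _))/= h] := ul (e%:C); first by rewrite ltcR.
rewrite -lecR -cplx_normE -(subrK (u (maxn K N)) l) (le_trans (ler_normD _ _))//.
by rewrite addrC (raddfD (real_complex R)) lerD// uM// leq_maxr.
Qed.

(** The real and imaginary parts are dominated by [M] separately, so both real series converge, and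
    the complex one is recombined from them. *)
Lemma cvg_series_dominatedC (u : nat -> Cplx R) (M : nat -> R) :
  (forall n, `|u n| <= (M n)%:C) -> cvgn (series M) -> cvgn (series u).
Proof.
move=> uM cM.
have M0 n : 0 <= M n by rewrite -ler0c (le_trans _ (uM n)).
have cv (f : Cplx R -> R) : (forall z, `|f z|%:C <= `|z|) -> cvgn (series (f \o u)).
  move=> fz; apply: normed_cvg; apply: series_le_cvg cM => // n; first exact: normr_ge0.
  by rewrite -(@lecR R) /=; exact: le_trans (fz _) (uM n).
have cR := cv (@complex.Re R) (@normc_ge_Re R).
have cI : cvgn (series (@complex.Im R \o u)).
  apply: cv => z; rewrite normc_def lecR -sqrtr_sqr ler_wsqrtr// lerDr.
  exact: sqr_ge0.
apply/cvg_ex; exists ((limn (series (@complex.Re R \o u)))%:C +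
  'i%C * (limn (series (@complex.Im R \o u)))%:C).
have -> : series u = (fun n => ((series (@complex.Re R \o u) n)%:C : Cplx R)) +
    (fun n => 'i%C * (series (@complex.Im R \o u) n)%:C).
  apply/funext => n; rewrite /= !fctE /series/= !(raddf_sum (real_complex R)).
  by rewrite mulr_sumr -big_split/=; apply: eq_bigr => i _; exact: complexE.
by apply: cvgD; [exact: cvg_real_complex|apply: cvgM;
  [exact: cvg_cst|exact: cvg_real_complex]].
Qed.

Lemma pgf_term_le q z n : 0 <= q n -> `|z| <= 1 ->
  `|(q n)%:C * z ^+ n : Cplx R| <= (q n)%:C.
Proof.
move=> q0 z1; rewrite normrM normrX [`|_%:C|]ger0_norm ?ler0c//.
by rewrite -[leRHS]mulr1 ler_wpM2l ?ler0c// exprn_ile1.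
Qed.

Definition summable_nonneg q := (forall n, 0 <= q n) /\ cvgn (series q).

Lemma pgf_cvg q z : summable_nonneg q -> `|z| <= 1 ->
  series (fun n => (q n)%:C * z ^+ n : Cplx R) @ \oo --> pgf q z.
Proof.
move=> [q0 cq] z1; suff: cvgn (series (fun n => (q n)%:C * z ^+ n : Cplx R)) by [].
by apply: cvg_series_dominatedC cq => n; exact: pgf_term_le.
Qed.

Lemma pgf_unique q z (v : Cplx R) :
  series (fun n => (q n)%:C * z ^+ n : Cplx R) @ \oo --> v -> pgf q z = v.
Proof. by move=> h; exact: (cvg_lim (@norm_hausdorff _ _) h). Qed.

(** The bound is the same for every [z] of the disc; this uniformity carries continuity up to the
    boundary. *)
Lemma pgf_tail_le q z N : summable_nonneg q -> `|z| <= 1 ->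
  `|pgf q z - series (fun n => (q n)%:C * z ^+ n : Cplx R) N| <=
  (limn (series q) - series q N)%:C.
Proof.
move=> sq z1; have [q0 cq] := sq.
apply: (@cplx_lim_norm_le (fun n => series (fun n =>
  (q n)%:C * z ^+ n : Cplx R) n - series (fun n =>
    (q n)%:C * z ^+ n : Cplx R) N) _ _ N).
  by apply: cvgB; [exact: pgf_cvg|exact: cvg_cst].
move=> n Nn; rewrite sub_series_geq// (le_trans (ler_norm_sum _ _ _))//.
apply: (@le_trans _ _ (\sum_(N <= k < n) (q k)%:C)).
  by apply: ler_sum => i _; exact: pgf_term_le.
rewrite -(raddf_sum (real_complex R)) lecR -(sub_series_geq q)// lerD2r.
apply: nondecreasing_cvgn_le => //; exact: nondecreasing_series.
Qed.

Lemma pgf_norm_le q z : summable_nonneg q -> `|z| <= 1 ->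
  `|pgf q z| <= (limn (series q))%:C.
Proof.
move=> sq z1; have := pgf_tail_le 0 sq z1.
by rewrite /series/= !big_geq// !subr0.
Qed.

End cplx_lemmas.

(** * Algebra and continuity of generating functions *)

Section pgf_ops.
Variable R : realType.
Implicit Types (q a b : nat -> R) (z w : Cplx R).

Definition conv (K : pzRingType) (a b : nat ->
  K) n := \sum_(i < n.+1) a i * b (n - i)%N.

Lemma ger0_series_norm q : (forall n, 0 <= q n) -> (fun n => `|q n| : R) = q.
Proof. by move=> q0; apply/funext => n; rewrite ger0_norm. Qed.

Lemma summable_nonneg_cvg q (s : R) :
  (forall n, 0 <= q n) -> series q @ \oo --> s -> summable_nonneg q.
Proof. by move=> q0 h; split => //; apply/cvg_ex; exists s. Qed.

Lemma conv_series a b : summable_nonneg a -> summable_nonneg b ->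
  series (conv a b) @ \oo --> limn (series a) * limn (series b).
Proof.
by move=> [a0 ca] [b0 cb]; apply: cvg_series_conv => //; rewrite ger0_series_norm.
Qed.

Lemma summable_conv a b : summable_nonneg a -> summable_nonneg b ->
  summable_nonneg (conv a b).
Proof.
move=> sa sb; apply: summable_nonneg_cvg (conv_series sa sb) => n.
by apply: sumr_ge0 => i _; rewrite mulr_ge0 ?(proj1 sa) ?(proj1 sb).
Qed.

Lemma pgf_abs_cvg q z : summable_nonneg q -> `|z| <= 1 ->
  cvgn (series (fun n => `|(q n)%:C * z ^+ n| : Cplx R)).
Proof.
move=> [q0 cq] z1; apply: cvg_series_dominatedC cq => n.
by rewrite normr_id pgf_term_le.
Qed.

Lemma pgf_conv a b z : summable_nonneg a -> summable_nonneg b -> `|z| <= 1 ->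
  pgf (conv a b) z = pgf a z * pgf b z.
Proof.
move=> sa sb z1; apply: pgf_unique.
have := cvg_series_conv (pgf_abs_cvg sa z1) (pgf_abs_cvg sb z1) (pgf_cvg sa z1)
  (pgf_cvg sb z1).
apply: eq_cvg_seq => N; apply: eq_bigr => n _.
rewrite /conv (raddf_sum (real_complex R)) mulr_suml; apply: eq_bigr => i _ /=.
rewrite (rmorphM (real_complex R)) mulrACA -exprD subnKC//.
by rewrite -ltnS.
Qed.

Lemma pgf_shift q z : summable_nonneg (fun n => q n.+1) -> `|z| <= 1 ->
  pgf q z = (q 0%N)%:C + z * pgf (fun n => q n.+1) z.
Proof.
move=> sq z1; apply: pgf_unique.
rewrite -cvg_shiftS /=.
have : (fun n => (q 0%N)%:C + z * series (fun n =>
  (q n.+1)%:C * z ^+ n : Cplx R) n : Cplx R) @ \oo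
   --> ((q 0%N)%:C + z * pgf (fun n => q n.+1) z : Cplx R).
  by apply: cvgD; [exact: cvg_cst|apply: cvgM; [exact: cvg_cst|exact: pgf_cvg]].
apply: eq_cvg_seq => n.
rewrite /series/= big_nat_recl// expr0 mulr1 mulr_sumr; congr (_ + _).
by apply: eq_bigr => i _; rewrite exprS mulrCA.
Qed.

Lemma pgf_lincomb (x y : R) a b z : summable_nonneg a -> summable_nonneg b ->
  `|z| <= 1 ->
  pgf (fun n => x * a n + y * b n) z = x%:C * pgf a z + y%:C * pgf b z.
Proof.
move=> sa sb z1; apply: pgf_unique.
have : (fun n => x%:C * series (fun n => (a n)%:C * z ^+ n : Cplx R) n +
    y%:C * series (fun n => (b n)%:C * z ^+ n : Cplx R) n : Cplx R) @ \oo
   --> (x%:C * pgf a z + y%:C * pgf b z : Cplx R).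
  by apply: cvgD; apply: cvgM; (exact: cvg_cst || exact: pgf_cvg).
apply: eq_cvg_seq => n.
rewrite /series/= !mulr_sumr -big_split/=; apply: eq_bigr => i _.
by rewrite (rmorphD (real_complex R)) !(rmorphM (real_complex R)) mulrDl !mulrA.
Qed.

Lemma summable_shift q : summable_nonneg (fun n =>
  q n.+1) -> 0 <= q 0%N -> summable_nonneg q.
Proof.
move=> [q0 cq] q00; split; first by case.
apply/cvg_ex; exists (q 0%N + limn (series (fun n => q n.+1))).
rewrite -cvg_shiftS /=.
have : (fun n => q 0%N + series (fun n =>
  q n.+1) n) @ \oo --> q 0%N + limn (series (fun n => q n.+1)).
  by apply: cvgD => //; exact: cvg_cst.
apply: eq_cvg_seq => n.
by rewrite /series/= big_nat_recl.
Qed.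

(** Summation by parts. With [t n] the probability of at least [n] arrivals, it yields the factor
    [1 - z] of [1 - A(z)]. *)
Lemma pgf_tail (t : nat -> R) z : summable_nonneg (fun n => t n.+1) -> 0 <= t 0%N ->
  `|z| <= 1 ->
  pgf (fun n => t n - t n.+1) z = (t 0%N)%:C - (1 - z) * pgf (fun n => t n.+1) z.
Proof.
move=> st t0 z1; have st' := summable_shift st t0.
transitivity (pgf (fun n => 1 * t n + (-1) * t n.+1) z).
  by rewrite (_ : (fun n => _) = (fun n => t n - t n.+1))//; apply/funext => n;
    rewrite mul1r mulN1r.
rewrite pgf_lincomb// (pgf_shift st z1) (rmorphN (real_complex R)) (rmorph1
  (real_complex R)).
ring.
Qed.

(** Partial sums are polynomials, hence continuous, and the remainders are uniformly small on the
    disc. The punctured filter within the disc is the one of [ratio_value]. *)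
Lemma pgf_continuous q z : summable_nonneg q -> `|z| <= 1 ->
  pgf q @ within (@unit_disc R) z^' --> pgf q z.
Proof.
move=> sq z1; have [q0 cq] := sq.
apply/cvgrPdist_lt => e /cplx_gt0E[-> e0]; set d := complex.Re e in e0 *.
have d4 : 0 < d / 4 by rewrite divr_gt0.
have [N _ /(_ N (leqnn N))/= hN] : \forall N \near \oo,
  `|limn (series q) - series q N| < d / 4.
  by move/cvgrPdist_lt : cq => /(_ _ d4).
have tailN w : `|w| <= 1 -> `|pgf q w - series (fun n =>
  (q n)%:C * w ^+ n : Cplx R) N| < (d / 4)%:C.
  move=> w1; apply: (le_lt_trans (pgf_tail_le N sq w1)).
  by rewrite ltcR (le_lt_trans (ler_norm _)).
pose S k (w : Cplx R) : Cplx R := series (fun n => (q n)%:C * w ^+ n : Cplx R) k.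
have cont : S N @ z --> S N z by exact: continuous_series_monomials.
have cont' : S N @ within (@unit_disc R) z^' --> S N z.
  by do 2 apply: cvg_within_filter.
have h : \forall w \near within (@unit_disc R) z^', `|S N z - S N w| < (d / 4)%:C.
  by move/cvgrPdist_lt : cont'; apply; rewrite ltcR.
near=> w.
have w1 : `|w| <= 1 by near: w; exact: withinT.
have hw : `|S N z - S N w| < (d / 4)%:C.
  by near: w.
have -> : pgf q z - pgf q w =
   (pgf q z - S N z) +
   (S N z - S N w)
   - (pgf q w - S N w) by rewrite opprB !addrA !subrK.
rewrite (le_lt_trans (ler_normB _ _))//.
have -> : d%:C = (d / 4)%:C + (d / 4)%:C + (d / 4)%:C + (d / 4)%:C :> R[i].
  by rewrite -!(raddfD (real_complex R)); congr (_%:C); field.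
apply: (@lt_trans _ _ ((d / 4)%:C + (d / 4)%:C + (d / 4)%:C)); last first.
  by rewrite ltrDl ltcR.
apply: ltrD; last exact: tailN.
by apply: (le_lt_trans (ler_normD _ _)); apply: ltrD => //; exact: tailN.
Unshelve. all: by end_near. Qed.

End pgf_ops.

(** Since [g] vanishes at [z0] at most, near [z] in the disc the ratio [f / g] is [pgf q], and
    continuity of [pgf q] identifies its limit. *)
Lemma ratio_value_pgf (R : realType) (q : nat -> R) (f g : Cplx R ->
  Cplx R) (z0 z : Cplx R) :
  summable_nonneg q ->
  (forall w : Cplx R, `|w| <= 1 -> pgf q w * g w = f w) ->
  (forall w : Cplx R, `|w| <= 1 -> g w = 0 -> w = z0) ->
  `|z| <= 1 -> ratio_value f g z (pgf q z).
Proof.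
move=> sq fg g0 z1; rewrite /ratio_value; case: eqP => [gz|/eqP gz]; last first.
  by rewrite -fg// mulfK.
have zE := g0 _ z1 gz.
have gneq : \forall w \near within (@unit_disc R) z^', g w != 0 /\ `|w| <= 1.
  near=> w; have w1 : `|w| <= 1 by near: w; exact: withinT.
  split => //; apply/eqP => /(g0 _ w1) wz; have : w != z by near: w;
    apply: cvg_within; exact: withinT.
  by rewrite wz zE eqxx.
split; first by move: gneq; apply: filterS => w [].
apply: cvg_trans (pgf_continuous sq z1).
apply: near_eq_cvg; move: gneq; apply: filterS => w [gw w1].
by rewrite -fg// mulfK.
Unshelve. all: by end_near. Qed.

(** * Stationary distribution of a positive recurrent chain *)

Section positive_recurrence.
Local Open Scope ereal_scope.
Context (R : realType).

(** The scalar may be [+oo]: then both sides are [+oo] if some selected term is positive, and 0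
    otherwise because [+oo * 0 = 0]. *)
Lemma ge0_nneseriesZl (u : nat -> \bar R) (P : pred nat) (x : \bar R) :
  0 <= x -> (forall n, 0 <= u n) ->
  \sum_(0 <= n <oo | P n) x * u n = x * \sum_(0 <= n <oo | P n) u n.
Proof.
move=> x0 u0; case: x x0 => [r r0| _|//]; first by rewrite nneseriesZl.
have [[n Pn un]|h] := pselect (exists2 n, P n & 0 < u n); last first.
  have uE n : P n -> u n = 0.
    by move=> Pn; apply/eqP; rewrite eq_le u0 andbT leNgt; apply/negP => un;
      apply: h; exists n.
  by rewrite !eseries0 ?mule0// => n _ Pn; rewrite uE// mule0.
have -> : \sum_(0 <= n <oo | P n) +oo * u n = +oo.
  apply: (@nneseries_pinfty _ _ _ n); [|exact: Pn|exact: gt0_mulye].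
  by move=> m _; rewrite mule_ge0.
rewrite gt0_mulye// (lt_le_trans un)// (nneseriesD1 (n := n))//.
by rewrite leeDl// nneseries_ge0.
Qed.

Lemma ge0_nneseriesZr (u : nat -> \bar R) (P : pred nat) (x : \bar R) :
  0 <= x -> (forall n, 0 <= u n) ->
  \sum_(0 <= n <oo | P n) u n * x = (\sum_(0 <= n <oo | P n) u n) * x.
Proof.
by move=> x0 u0; rewrite muleC -ge0_nneseriesZl//; apply: eq_eseriesr => n _;
  rewrite muleC.
Qed.

(** The term [t m] occurs in the tails starting at 0, ..., [m]. For a return-time law this equates
    the sum of the survival probabilities with the mean. *)
Lemma nneseries_tails (t : nat -> \bar R) : (forall n, 0 <= t n) ->
  \sum_(0 <= n <oo) \sum_(n <= m <oo) t m = \sum_(0 <= m <oo) m.+1%:R%:E * t m.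
Proof.
move=> t0.
transitivity (\sum_(0 <= n <oo) \sum_(0 <= m <oo) if (n <= m)%N then t m else 0).
  by apply: eq_eseriesr => n _; rewrite eseries_cond eseries_mkcondr.
rewrite nneseries_interchange => [|i j]; last by case: ifP.
apply: eq_eseriesr => m _; rewrite (nneseries_split 0 m.+1) => [|k _];
  last by case: ifP.
rewrite eseries0 ?adde0; last by move=> k mk _; rewrite leqNgt mk.
rewrite add0n big_nat (eq_bigr (fun=> t m)); last by move=> k /andP[_];
  rewrite ltnS => ->.
by rewrite -big_nat mule_natl sumr_const_nat subn0.
Qed.

(* Probability of being in [k] at time [n.+1], started from [i], without a visit
   to [i] at the times 1, ..., n. *)
Fixpoint taboo (p : nat -> nat -> R) (i n k : nat) : \bar R :=
  if n is m.+1 then \sum_(0 <= l <oo | l != i) taboo p i m l * (p l k)%:E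
  else (p i k)%:E.

Section taboo.
Variables (p : nat -> nat -> R) (i : nat).
Hypothesis p_ge0 : forall m n, (0 <= p m n)%R.
Hypothesis p_sum1 : forall m, \sum_(0 <= n <oo) (p m n)%:E = 1.

Lemma taboo_ge0 n k : 0 <= taboo p i n k.
Proof.
elim: n k => [|n IH] k /=; first by rewrite lee_fin.
by apply: nneseries_ge0 => l _ _; rewrite mule_ge0 ?lee_fin.
Qed.

Lemma first_passage_ge0 n k : 0 <= first_passage p n k i.
Proof.
elim: n k => [|n IH] k /=; first by rewrite lee_fin.
by apply: nneseries_ge0 => l _ _; rewrite mule_ge0 ?lee_fin.
Qed.

(** A first return to [i] at time [a + b + 2] is split at its position [k != i] at time [a + 1]. The
    induction on [b] moves one step at a time from [first_passage], which peels off the first step,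
    to [taboo], which peels off the last. *)
Lemma taboo_first_passage a b :
  \sum_(0 <= k <oo | k != i) taboo p i a k * first_passage p b k i = taboo p i (a +
    b).+1 i.
Proof.
elim: b a => [|b IH] a; first by rewrite addn0.
rewrite addnS -addSn -IH /=.
under eq_eseriesr => k _.
  rewrite -ge0_nneseriesZl ?taboo_ge0//; last by move=> l;
    rewrite mule_ge0 ?lee_fin ?first_passage_ge0.
  over.
rewrite nneseries_interchange => [|k l];
  last by rewrite !mule_ge0 ?lee_fin ?first_passage_ge0 ?taboo_ge0.
apply: eq_eseriesr => l _; rewrite -ge0_nneseriesZr ?first_passage_ge0//.
  by apply: eq_eseriesr => k _; rewrite muleA.
by move=> k; rewrite mule_ge0 ?lee_fin ?taboo_ge0.
Qed.

Lemma first_passageE n : first_passage p n i i = taboo p i n i.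
Proof. by case: n => // n; rewrite -(taboo_first_passage 0 n). Qed.

Let S n := \sum_(0 <= k <oo) taboo p i n k.

(** [S n] is the probability of no return to [i] up to time [n]; the path then either returns at
    time [n.+1] or survives one step more. *)
Lemma taboo_mass n : S n = taboo p i n i + S n.+1.
Proof.
rewrite {1}/S (nneseriesD1 (n := i))//; last by move=> k _; exact: taboo_ge0.
congr (_ + _); rewrite /S/= [RHS]nneseries_interchange => [|k l];
  last by rewrite mule_ge0 ?lee_fin ?taboo_ge0.
apply: eq_eseriesr => k _; rewrite ge0_nneseriesZl ?taboo_ge0//.
  by rewrite p_sum1 mule1.
by move=> l; rewrite lee_fin.
Qed.

Hypothesis recurrent : \sum_(0 <= n <oo) first_passage p n i i = 1.
Hypothesis positive : \sum_(0 <= n <oo) (n.+1%:R)%:E * first_passage p n i i < +oo.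

Let t n := taboo p i n i.

Lemma taboo_ret : \sum_(0 <= n <oo) t n = 1.
Proof. by rewrite -recurrent; apply: eq_eseriesr => n _; rewrite first_passageE. Qed.

(** Recurrence starts the induction, both sides being 1 at [n = 0]; [taboo_mass] then removes one
    finite term from each. *)
Lemma taboo_tail n : S n = \sum_(n <= m <oo) t m.
Proof.
elim: n => [|n IH]; first by rewrite taboo_ret /S/= p_sum1.
have : t n + S n.+1 = t n + \sum_(n.+1 <= m <oo) t m.
  rewrite -taboo_mass IH (nneseries_split n 1) => [|k _]; last exact: taboo_ge0.
  by rewrite addn1 big_nat1.
have tfin : t n \is a fin_num.
  rewrite ge0_fin_numE ?taboo_ge0// (@le_lt_trans _ _ 1) ?ltry// -taboo_ret.
  by rewrite (nneseriesD1 (n := n)) ?leeDl ?nneseries_ge0// => *; exact: taboo_ge0.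
by move/(congr1 (fun x => x - t n)); rewrite ![t n + _]addeC !addeK.
Qed.

(** Expected number of visits to [k] from time 1 up to and including the first return to [i]. *)
Let u k := \sum_(0 <= n <oo) taboo p i n k.

(** The visits to all states together count the length of the excursion, so the total is the mean
    return time. *)
Lemma occupation_total : \sum_(0 <= k <oo) u k < +oo.
Proof.
rewrite nneseries_interchange; last by move=> *; exact: taboo_ge0.
under eq_eseriesr do rewrite -/(S _) taboo_tail.
rewrite nneseries_tails; last by move=> *; exact: taboo_ge0.
rewrite (eq_eseriesr (g := fun n => n.+1%:R%:E * first_passage p n i i))// => n _.
by rewrite first_passageE.
Qed.

(** Every visit to [k] in the excursion is reached either by the first step out of [i], which is the
    term [l = i] because [u i = 1], or from an earlier visit to some [l != i]. *)
Lemma occupation_invariant k : u k = \sum_(0 <= l <oo) u l * (p l k)%:E.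
Proof.
have u0 l : 0 <= u l by apply: nneseries_ge0 => *; exact: taboo_ge0.
rewrite (nneseriesD1 (n := i))//; last by move=> l _; rewrite mule_ge0 ?lee_fin.
rewrite [u i]taboo_ret mul1e {1}/u (nneseries_split 0 1); last by move=> *;
  exact: taboo_ge0.
rewrite add0n big_nat1; congr (_ + _).
rewrite -nneseries_addn; last by move=> *; exact: taboo_ge0.
under eq_eseriesr do rewrite addn1 /=.
rewrite nneseries_interchange; last by move=> *; rewrite mule_ge0 ?lee_fin ?taboo_ge0.
by apply: eq_eseriesr => l _; rewrite ge0_nneseriesZr ?lee_fin// => n; exact: taboo_ge0.
Qed.

Lemma positive_recurrent_stationary :
  exists2 pi, stationary_distribution p pi & (0 < pi i)%R.
Proof.
have u0 l : 0 <= u l by apply: nneseries_ge0 => *; exact: taboo_ge0.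
have tot := occupation_total.
have ule k : u k <= \sum_(0 <= k <oo) u k.
  by rewrite (nneseriesD1 (n := k)) ?leeDl ?nneseries_ge0.
have ufin k : u k \is a fin_num by rewrite ge0_fin_numE// (le_lt_trans (ule k)).
have Ufin : \sum_(0 <= k <oo) u k \is a fin_num by rewrite ge0_fin_numE// nneseries_ge0.
have ui : u i = 1 by exact: taboo_ret.
pose U := fine (\sum_(0 <= k <oo) u k).
have U0 : (0 < U)%R by rewrite fine_gt0// tot andbT (lt_le_trans _ (ule i))// ui.
exists (fun k => U^-1 * fine (u k))%R; last by rewrite ui /= mulr1 invr_gt0.
split => [k||k].
- by rewrite mulr_ge0 ?invr_ge0 ?(ltW U0) ?fine_ge0.
- under eq_eseriesr do rewrite EFinM fineK//.
  by rewrite nneseriesZl// -(fineK Ufin) -EFinM mulVf ?gt_eqF.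
- rewrite EFinM fineK// {1}occupation_invariant -nneseriesZl.
    by apply: eq_eseriesr => l _; rewrite !EFinM fineK// muleA.
  by move=> l _; rewrite mule_ge0 ?lee_fin.
Qed.
End taboo.
End positive_recurrence.

(** * The orbit chain *)

Section orbit_chain.
Context (R : realType) (alpha rho_e rho_r : R) (te tr : nat -> R).
Hypotheses (alpha01 : 0 <= alpha <= 1) (te1 : te 0%N = 1) (tr1 : tr 0%N = 1).
Hypotheses (te_ge0 : forall n, 0 <= te n) (tr_ge0 : forall n, 0 <= tr n).
Hypotheses (te_le : forall n, te n.+1 <= te n) (tr_le : forall n, tr n.+1 <= tr n).
Hypothesis te_sum : series (fun n => te n.+1) @ \oo --> rho_e.
Hypothesis tr_sum : series (fun n => tr n.+1) @ \oo --> rho_r.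

(* [te n] and [tr n] are the probabilities of at least [n] arrivals during a
   service of type e and r. From a state m.+1 the chain jumps to m + K, where K
   has generating function alpha A_r(z) + (1 - alpha) z A_e(z); [c j] is the
   probability that K > j and [kappa] is the mean of K. *)
Let be n := te n - te n.+1.
Let br n := tr n - tr n.+1.
Let c j := (1 - alpha) * te j + alpha * tr j.+1.
Let p := orbit_chain alpha be br.
Let kappa := (1 - alpha) * (1 + rho_e) + alpha * rho_r.

Let se : summable_nonneg (fun n => te n.+1).
Proof. by apply: summable_nonneg_cvg te_sum. Qed.
Let sr : summable_nonneg (fun n => tr n.+1).
Proof. by apply: summable_nonneg_cvg tr_sum. Qed.

Lemma orbit_chain0 m n : (n.+2 <= m)%N -> p m n = 0.
Proof.
case: m => // m nm; rewrite /p /orbit_chain/= leqNgt (ltn_trans _ nm)//= eqSS.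
by case: eqP nm => // ->; rewrite ltnn.
Qed.

(** Reaching [n] from [i.+1] means [K = n - i], whose probability is a difference of consecutive
    tails of [K]. *)
Lemma orbit_chain_lt i n : (i < n)%N -> p i.+1 n = c (n - i.+1)%N - c (n - i)%N.
Proof.
by move=> ni; rewrite /p /orbit_chain/= ni /c /be /br -(subnSK ni); ring.
Qed.

Lemma orbit_chain_eq n : p n.+1 n = 1 - c 0%N.
Proof.
by rewrite /p /orbit_chain/= ltnn eqxx /c /br te1 tr1; ring.
Qed.

(* Level crossing: the flow from [0, n] up to ]n, oo[ equals the flow down from
   n.+1 to n. The difference of the two sides at n and at n.+1 is the
   stationarity equation at n. *)
Lemma stationary_levelE (pi : nat -> R) :
  (forall n, pi n = \sum_(m < n.+2) pi m * p m n) <->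
  (forall n, pi n.+1 = pi 0%N * te n.+1 + conv (fun n => pi n.+1) c n).
Proof.
(* [G n.+1] is the defect of the level equation at [n], and [G 0 = 0] because [te 0 = 1].
   Consecutive differences of [G] are the defects of stationarity, so all defects of one kind vanish
   iff all of the other kind do. *)
pose G n := pi n - pi 0%N * te n - \sum_(i < n) pi i.+1 * c (n.-1 - i)%N.
have G0 : G 0%N = 0 by rewrite /G big_ord0 te1 mulr1 subrr subr0.
have GS n : G n.+1 = pi n.+1 - (pi 0%N * te n.+1 + conv (fun n => pi n.+1) c n).
  by rewrite /G /conv/= opprD addrA.
have GB n : G n - G n.+1 = pi n - \sum_(m < n.+2) pi m * p m n.
  rewrite big_ord_recl /=; rewrite /bump/=.
  under eq_bigr do rewrite add1n.
  rewrite big_ord_recr/= orbit_chain_eq// GS /G /conv big_ord_recr/= subnn.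
  under [in RHS]eq_bigr => i _ do rewrite orbit_chain_lt// mulrBr.
  rewrite sumrB.
  have -> : \sum_(i < n) pi i.+1 * c (n.-1 - i)%N = \sum_(i < n) pi i.+1 * c (n -
    i.+1)%N.
    by apply: eq_bigr => i _; rewrite subnS -subn1 subnAC subn1.
  by rewrite /p /orbit_chain/= /be; ring.
split => h.
  have G00 n : G n = 0.
    elim: n => // n IH; apply/eqP; rewrite -oppr_eq0 -[X in X == 0]add0r -{1}IH GB -h
      subrr//.
  by move=> n; apply/eqP; rewrite -subr_eq0 -GS G00.
have G00 n : G n = 0 by case: n => // n; rewrite GS -h subrr.
by move=> n; apply/eqP; rewrite -subr_eq0 -GB !G00 subrr.
Qed.

Lemma orbit_chain_ge0 m n : 0 <= p m n.
Proof.
move: alpha01 => /andP[a0 a1].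
have be0 k : 0 <= be k by rewrite subr_ge0.
have br0 k : 0 <= br k by rewrite subr_ge0.
rewrite /p /orbit_chain; case: ifP => // _; case: ifP => _.
  by rewrite addr_ge0// mulr_ge0// subr_ge0.
by case: ifP => // _; rewrite mulr_ge0.
Qed.

Lemma jump_tail_ge0 n : 0 <= c n.
Proof. by move: alpha01 => /andP[a0 a1]; rewrite addr_ge0// mulr_ge0// subr_ge0. Qed.

Lemma te_full_sum : series te @ \oo --> 1 + rho_e.
Proof.
rewrite -cvg_shiftS/= -te1.
have : (fun n => te 0%N + series (fun n => te n.+1) n) @ \oo --> te 0%N + rho_e.
  by apply: cvgD => //; exact: cvg_cst.
by apply: eq_cvg_seq => n; rewrite /series/= big_nat_recl.
Qed.

Lemma jump_tail_sum : series c @ \oo --> kappa.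
Proof.
have : (fun n => (1 - alpha) * series te n + alpha * series (fun n =>
  tr n.+1) n) @ \oo --> kappa.
  by apply: cvgD; apply: cvgM => //; [exact: cvg_cst|exact: te_full_sum|exact: cvg_cst].
by apply: eq_cvg_seq => n; rewrite /series/= !mulr_sumr -big_split.
Qed.

Let sc : summable_nonneg c.
Proof. exact: summable_nonneg_cvg jump_tail_ge0 jump_tail_sum. Qed.

(** [c 0] is the first term of a nonnegative series with sum [kappa]. It permits division by
    [1 - c 0] in the recursion for [pi]. *)
Lemma jump_tail0_lt1 : kappa < 1 -> c 0%N < 1.
Proof.
apply: le_lt_trans; have -> : c 0%N = series c 1 by rewrite /series/= big_nat1.
exact: nonneg_series_le jump_tail_ge0 jump_tail_sum.
Qed.

(** The chain descends by at most one, so column [n] vanishes from row [n.+2] on and the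
    extended-real balance equations are finite real sums. *)
Lemma stationary_distributionP (pi : nat -> R) :
  stationary_distribution p pi <->
  [/\ forall n, 0 <= pi n, series pi @ \oo --> (1 : R) &
     forall n, pi n.+1 = pi 0%N * te n.+1 + conv (fun n => pi n.+1) c n].
Proof.
have fin n : (forall n, 0 <= pi n) ->
    (\sum_(0 <= m <oo) (pi m * p m n)%:E = (\sum_(m < n.+2) pi m * p m n)%:E)%E.
  move=> pi0; apply: nneseries_finite => m; first by rewrite mulr_ge0// orbit_chain_ge0.
  by move=> nm; rewrite orbit_chain0 ?mulr0.
split=> [[pi0 pi1 st]|[pi0 pi1 st]]; split => //.
- exact: nneseries_cvg.
- by apply/stationary_levelE => // n; have := st n; rewrite fin// => -[].
- by rewrite nneseries_limn ?(cvg_lim (@Rhausdorff R) pi1)//; apply/cvg_ex; exists 1.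
- by move=> n; rewrite fin//; congr EFin; move: n; apply/stationary_levelE.
Qed.

(** Summing the level equation over [n], the convolution contributes [s * kappa]. *)
Lemma level_mass (pi : nat -> R) (s : R) : (forall n, 0 <= pi n) ->
  (forall n, pi n.+1 = pi 0%N * te n.+1 + conv (fun n => pi n.+1) c n) ->
  series (fun n => pi n.+1) @ \oo --> s ->
  (1 - kappa) * s = pi 0%N * rho_e.
Proof.
move=> pi0 lv pis; have sp := summable_nonneg_cvg (fun n => pi0 n.+1) pis.
have := conv_series sp sc.
rewrite (cvg_lim (@Rhausdorff R) pis) (cvg_lim (@Rhausdorff R) jump_tail_sum) => h.
have : series (fun n => pi n.+1) @ \oo --> pi 0%N * rho_e + s * kappa.
  have : (fun n => pi 0%N * series (fun n => te n.+1) n + series (conv (fun n =>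
    pi n.+1) c) n) @ \oo --> pi 0%N * rho_e + s * kappa.
    by apply: cvgD => //; apply: cvgM => //; exact: cvg_cst.
  apply: eq_cvg_seq => n; rewrite /series/= mulr_sumr -big_split/=.
  by apply: eq_bigr => i _; rewrite lv.
move/(cvg_lim (@Rhausdorff R)); rewrite (cvg_lim (@Rhausdorff R) pis) => hs.
by rewrite mulrBl mul1r {1}hs; ring.
Qed.

Lemma stationary_mass (pi : nat -> R) : stationary_distribution p pi ->
  (1 - kappa) * (1 - pi 0%N) = pi 0%N * rho_e.
Proof. by move=> /stationary_distributionP[pi0 /series_shift_cvg pis lv];
  exact: level_mass. Qed.

(** The mass identity determines [pi 0]; the level equation is then a triangular system with
    diagonal [1 - c 0], which is positive. *)
Lemma stationary_unique (pi pi' : nat -> R) : kappa < 1 -> 0 <= rho_e ->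
  stationary_distribution p pi -> stationary_distribution p pi' -> pi' = pi.
Proof.
move=> k1 r0 st st'; have m := stationary_mass st; have m' := stationary_mass st'.
have pi00 : pi' 0%N = pi 0%N.
  apply: (@mulfI _ (1 - kappa + rho_e)); first by rewrite gt_eqF// ltr_wpDr// subr_gt0.
  by lra.
move: st st' => /stationary_distributionP[_ _ lv] /stationary_distributionP[_ _ lv'].
apply/funext => n; elim/ltn_ind: n => -[//|n IH].
have E (q : nat -> R) : (forall n, q n.+1 = q 0%N * te n.+1 + conv (fun n =>
  q n.+1) c n) ->
   (1 - c 0%N) * q n.+1 = q 0%N * te n.+1 + \sum_(i < n) q i.+1 * c (n - i)%N.
  by move=> h; rewrite mulrBl {1}h /conv big_ord_recr/= subnn; ring.
apply: (@mulfI _ (1 - c 0%N)); first by rewrite gt_eqF// subr_gt0 jump_tail0_lt1.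
rewrite !E// pi00; congr (_ + _); apply: eq_bigr => i _.
by rewrite IH// ltnS.
Qed.


Lemma stationary_exists : kappa < 1 -> 0 <= rho_e ->
  exists pi, stationary_distribution p pi.
Proof.
move=> k1 r0; have c01 := jump_tail0_lt1 k1.
have D0 : 0 < 1 - kappa + rho_e by rewrite ltr_wpDr// subr_gt0.
(* The value forced by [stationary_mass]. *)
pose pi0 := (1 - kappa) / (1 - kappa + rho_e).
have pi00 : 0 <= pi0 by rewrite divr_ge0 ?subr_ge0 ?(ltW k1) ?(ltW D0).
(* The level equation solved for its newest term: the convolution contains [v n * c 0], which is
   moved to the left. *)
have [v vE] : exists v : nat -> R, forall n, v n =
    (pi0 * te n.+1 + \sum_(i < n) v i * c (n - i)%N) / (1 - c 0%N).
  apply: (strong_recursion (f := fun n v =>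
    (pi0 * te n.+1 + \sum_(i < n) v i * c (n - i)%N) / (1 - c 0%N)) 0) => n u w uw.
  by congr ((_ + _) / _); apply: eq_bigr => i _; rewrite uw.
have v0 n : 0 <= v n.
  elim/ltn_ind: n => n IH; rewrite vE; apply: divr_ge0; last by rewrite subr_ge0 ltW.
  apply: addr_ge0; first by rewrite mulr_ge0.
  by apply: sumr_ge0 => i _; rewrite mulr_ge0 ?IH// jump_tail_ge0.
have vconv n : v n = pi0 * te n.+1 + conv v c n.
  rewrite /conv big_ord_recr/= subnn addrA.
  have /(congr1 (fun x => x * (1 - c 0%N))) := vE n.
  by rewrite divfK ?subr_eq0 ?gt_eqF// => <-; ring.
have cT n : series c n <= kappa by exact: nonneg_series_le jump_tail_ge0 jump_tail_sum.
have eT n : series (fun n => te n.+1) n <= rho_e by exact: nonneg_series_le te_sum.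
(* A partial sum [V] of [v] satisfies [V <= pi0 * rho_e + V * kappa], since each inner sum over [c]
   is at most [kappa]; with [kappa < 1] this bounds [V] uniformly. *)
have vT n : series v n <= pi0 * rho_e / (1 - kappa).
  rewrite ler_pdivlMr ?subr_gt0// mulrBr mulr1 lerBlDr.
  have {1}-> : series v n = pi0 * series (fun n => te n.+1) n + series (conv v c) n.
    by rewrite /series/= mulr_sumr -big_split/=; apply: eq_bigr => i _; exact: vconv.
  rewrite lerD ?ler_wpM2l ?eT//.
  rewrite /series/= series_convE big_mkord mulr_suml; apply: ler_sum => i _.
  by rewrite ler_wpM2l//; exact: cT.
have cv : cvgn (series v).
  apply: nondecreasing_is_cvgn; first exact: nondecreasing_series (fun n _ _ => v0 n).
  by exists (pi0 * rho_e / (1 - kappa)) => _ [n _ <-]; exact: vT.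
pose pi n := if n is m.+1 then v m else pi0.
have pige0 n : 0 <= pi n by case: n.
have lv n : pi n.+1 = pi 0%N * te n.+1 + conv (fun n => pi n.+1) c n by exact: vconv.
exists pi; apply/stationary_distributionP; split => //.
have m := level_mass pige0 lv cv.
rewrite -cvg_shiftS/=.
have vs : limn (series v) = 1 - pi0.
  apply: (@mulfI _ (1 - kappa)); first by rewrite gt_eqF// subr_gt0.
  rewrite m /= /pi0; field; first by rewrite gt_eqF.
have : (fun n => pi0 + series v n) @ \oo --> pi0 + limn (series v).
  by apply: cvgD => //; exact: cvg_cst.
rewrite vs addrC subrK; apply: eq_cvg_seq => n.
by rewrite /series/= big_nat_recl.
Qed.

Let K (z : Cplx R) : Cplx R := alpha%:C * pgf br z + (1 - alpha%:C) * (z * pgf be z).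

Lemma pgf_tail_e z : `|z| <= 1 -> pgf be z = 1 - (1 - z) * pgf (fun n => te n.+1) z.
Proof. by move=> z1; rewrite /be pgf_tail ?te1. Qed.

Lemma pgf_tail_r z : `|z| <= 1 -> pgf br z = 1 - (1 - z) * pgf (fun n => tr n.+1) z.
Proof. by move=> z1; rewrite /br pgf_tail ?tr1. Qed.

Lemma jump_pgf_factor z : `|z| <= 1 -> 1 - K z = (1 - z) * pgf c z.
Proof.
move=> z1; have st := summable_shift se (te_ge0 0%N).
rewrite /c pgf_lincomb// (pgf_shift se z1) te1 /K pgf_tail_e// pgf_tail_r//.
have -> : (1 - alpha)%:C = 1 - alpha%:C :> Cplx R
  by exact: (rmorphB (real_complex R) 1 alpha).
have -> : 1%:C = 1 :> Cplx R by [].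
move: (pgf (fun n => tr n.+1) z) (pgf (fun n => te n.+1) z) (alpha%:C) => x y t.
by ring.
Qed.

Lemma jump_pgf_fixpoint z : kappa < 1 -> `|z| <= 1 -> z - K z = 0 -> z = 1.
Proof.
move=> k1 z1 h; have : (1 - z) * (pgf c z - 1) = 0.
  by rewrite mulrBr -jump_pgf_factor// mulr1 -[RHS]h opprB addrC addrA subrK.
move/eqP; rewrite mulf_eq0 => /orP[|]; rewrite subr_eq0 => /eqP// h1.
have := pgf_norm_le sc z1; rewrite h1 normr1 (cvg_lim (@Rhausdorff R) jump_tail_sum).
by rewrite -(rmorph1 (real_complex R)) lecR leNgt k1.
Qed.

Lemma pgf_stationary pi z : stationary_distribution p pi -> `|z| <= 1 ->
  pgf pi z * (z - K z) = (pi 0%N)%:C * (z * pgf be z - K z).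
Proof.
move=> /stationary_distributionP[pi0 pi1 lv] z1.
have sp : summable_nonneg (fun n => pi n.+1).
  by apply: summable_nonneg_cvg (series_shift_cvg pi1) => n.
have V : pgf (fun n => pi n.+1) z =
    (pi 0%N)%:C * pgf (fun n => te n.+1) z + pgf (fun n => pi n.+1) z * pgf c z.
  rewrite -(pgf_conv sp sc z1) -[X in _ + X]mul1r -(rmorph1 (real_complex R)).
  rewrite -pgf_lincomb//; last exact: summable_conv.
  by congr (pgf _ z); apply/funext => n; rewrite mul1r lv.
rewrite (pgf_shift sp z1) pgf_tail_e//.
have -> : K z = 1 - (1 - z) * pgf c z by rewrite -jump_pgf_factor// opprB addrC subrK.
move: V; move: (pgf (fun n => pi n.+1) z) (pgf (fun n =>
  te n.+1) z) (pgf c z) ((pi 0%N)%:C) => v t y u V.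
apply/eqP; rewrite -subr_eq0; apply/eqP.
(* The two sides differ by [(1 - z) * z] times the defect of the level equation [V] for generating
   functions. *)
transitivity ((1 - z) * z * (u * t + v * y - v)); first by ring.
by rewrite -V subrr mulr0.
Qed.

Let p_ge0 m n : 0 <= p m n.
Proof. exact: orbit_chain_ge0. Qed.

(** Partial row sums telescope to [1 - te n] from state 0, and to [1 - c n] from [m.+1] once the sum
    runs over targets up to [m + n]; the tails tend to 0 because they are summable. *)
Lemma orbit_chain_row m : (\sum_(0 <= n <oo) (p m n)%:E = 1)%E.
Proof.
suff h : series (p m) @ \oo --> (1 : R).
  by rewrite nneseries_limn ?(cvg_lim (@Rhausdorff R) h)//; apply/cvg_ex; exists 1.
case: m => [|m].
  have te0 : (fun n => 1 - te n) @ \oo --> (1 : R).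
    rewrite -[X in _ --> X]subr0; apply: cvgB; first exact: cvg_cst.
    by apply: cvg_series_cvg_0; apply/cvg_ex; exists (1 + rho_e); exact: te_full_sum.
  move: te0; apply: eq_cvg_seq => n; rewrite /series/=; elim: n => [|n IH].
    by rewrite big_geq// te1 subrr.
  by rewrite big_nat_recr//= -IH /p /orbit_chain/= /be; ring.
have cc : cvgn (series c) by apply/cvg_ex; exists kappa; exact: jump_tail_sum.
have c0 : (fun n => 1 - c n) @ \oo --> (1 : R).
  rewrite -[X in _ --> X]subr0; apply: cvgB; first exact: cvg_cst.
  exact: cvg_series_cvg_0 cc.
rewrite -(cvg_shiftn m.+1) /=.
move: c0; apply: eq_cvg_seq => n; elim: n => [|n IH].
  rewrite add0n /series/= big_nat_recr//= orbit_chain_eq// big_nat big1 ?add0r//.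
  by move=> i /andP[_ im]; rewrite orbit_chain0.
rewrite addSn /series/= big_nat_recr//=.
rewrite -[\sum_(0 <= i < n + m.+1) _]/(series (p m.+1) (n + m.+1)) -IH.
rewrite orbit_chain_lt; last by rewrite addnS ltnS leq_addl.
by rewrite addnK addnS -addSn addnK /c; ring.
Qed.

(** If [rho_e] were 0, every [te n.+1] would vanish, so state 0 would be absorbing and state 1 out
    of its reach. *)
Lemma irreducible_rho_gt0 : irreducible p -> 0 < rho_e.
Proof.
move=> irr.
have eT n : series (fun n => te n.+1) n <= rho_e by exact: nonneg_series_le te_sum.
have r0 : 0 <= rho_e by rewrite (le_trans _ (eT 0%N))// /series/= big_geq.
rewrite lt_neqAle r0 andbT; apply/eqP => re0.
have teS n : te n.+1 = 0.
  apply/eqP; rewrite eq_le te_ge0 andbT re0 (le_trans _ (eT n.+1))//.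
  by rewrite /series/= big_nat_recr//= lerDr sumr_ge0.
have [n] := irr 0%N 1%N; suff -> : nstep p n 0 1 = 0%E by rewrite ltxx.
elim: n => [|n IH] //=.
apply: eseries0 => -[_ _|k _ _]; first by rewrite IH mule0.
by rewrite {1}/p /orbit_chain/= /be !teS subrr mul0e.
Qed.

(** With [pi 0 > 0] and [rho_e > 0] the right side of the mass identity is positive, while
    [1 - pi 0 >= 0]; hence [1 - kappa] is positive. *)
Lemma ergodic_kappa_lt1 : ergodic p -> kappa < 1.
Proof.
move=> [irr _ /(_ 0%N)[rec pos]]; have r0 := irreducible_rho_gt0 irr.
have [pi st pi0] := positive_recurrent_stationary p_ge0 orbit_chain_row rec pos.
have h := stationary_mass st.
have pi1 : pi 0%N <= 1.
  have [pige0 pis _] := st; rewrite -lee_fin -pis (nneseriesD1 (n := 0%N))//;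
    last by move=> k _; rewrite lee_fin.
  by rewrite leeDl// nneseries_ge0// => n _ _; rewrite lee_fin.
have : 0 < (1 - kappa) * (1 - pi 0%N) by rewrite h mulr_gt0.
case: (ltP kappa 1) => // k1.
have k : (1 - kappa) * (1 - pi 0%N) <= 0.
  by apply: mulr_le0_ge0; [rewrite subr_le0|rewrite subr_ge0].
by rewrite ltNge k.
Qed.

End orbit_chain.

(** * Partial sums of independent exponential holding times *)

Lemma bigcap_cons (I : eqType) (U : Type) (F : I -> set U) (x : I) (s : seq I) :
  \bigcap_(i in [set` x :: s]) F i = F x `&` \bigcap_(i in [set` s]) F i.
Proof.
apply/seteqP; split=> [w h|w [hx hs] i /=].
  by split=> [|i si]; apply: h; rewrite /= inE ?eqxx// orbC [i \in s]si.
by rewrite inE => /predU1P[->//|]; exact: hs.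
Qed.

Lemma bigcap_seq1 (I : eqType) (U : Type) (F : I -> set U) (x : I) :
  \bigcap_(i in [set` [:: x]]) F i = F x.
Proof.
by rewrite bigcap_cons; apply/seteqP; split=> [w []//|w Fw]; split.
Qed.

Section independence.
Local Open Scope ereal_scope.
Context d (Omega : measurableType d) (R : realType) (P : probability Omega R).

(** Finite measures that agree on rectangles coincide. The event [E] stands for conditions on
    further variables; its probability is absorbed as a scaling of the law of [Y]. *)
Lemma joint_law_product (X Y : {mfun Omega >-> R}) (E : set Omega) : measurable E ->
  (forall A B, measurable A -> measurable B ->
    P (X @^-1` A `&` (Y @^-1` B `&` E)) = P (X @^-1` A) * (P (Y @^-1` B) * P E)) ->
  forall Z : set (R * R), measurable Z ->
    P ((fun w => (X w, Y w)) @^-1` Z `&` E) =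
    (distribution P X \x distribution P Y) Z * P E.
Proof.
move=> mE XYE Z mZ.
have mXY : measurable_fun [set: Omega] (fun w => (X w, Y w))
  by exact: measurable_fun_pair.
have PE0 : (0 <= fine (P E))%R by exact: fine_ge0.
have PEE : P E = (fine (P E))%:E by rewrite fineK// fin_num_measure.
pose XY w := (X w, Y w).
pose m'_ : {measure set (R * R) -> \bar R} := pushforward (mrestr P mE) XY.
pose m' := m'_ mXY.
have <- : m' Z = P ((fun w => (X w, Y w)) @^-1` Z `&` E) by [].
rewrite -(@product_measure_unique _ _ _ _ R (distribution P X)
  (mscale (NngNum PE0) (distribution P Y)) m')//.
  rewrite muleC [in RHS]PEE /product_measure1 -ge0_integralZl//.
  exact: measurable_fun_xsection.
move=> A B mA mB.
have -> : m' (A `*` B) = P (X @^-1` A `&` (Y @^-1` B `&` E)) by rewrite setIA.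
by rewrite XYE// /mscale/= [in LHS]PEE [P (Y @^-1` B) * _]muleC.
Qed.

Variable T : nat -> {RV P >-> R}.
Hypothesis indep : mutually_independent T.

Fixpoint partial_sum n : {mfun Omega >-> R} :=
  if n is m.+1 then (partial_sum m + (T m : {mfun Omega >-> R}))%R else cst 0%R.

Lemma partial_sumE n w : partial_sum n w = (\sum_(i < n) T i w)%R.
Proof. by elim: n => [|n IH] /=; rewrite ?big_ord0// big_ord_recr/= -IH. Qed.

Let cyl (s : seq nat) (B : nat -> set R) := \bigcap_(i in [set` s]) (T i @^-1` B i).

Lemma cyl_measurable s B : (forall i, measurable (B i)) -> measurable (cyl s B).
Proof.
move=> mB; apply: fin_bigcap_measurable => [|i _]; first exact: finite_seq.
by rewrite -[_ @^-1` _]setTI; exact: measurable_funP.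
Qed.

(* The cylinder on later holding times strengthens the induction hypothesis: the
   step from [n] to [n.+1] takes [T n] out of it. *)
Lemma partial_sum_indep n (s : seq nat) (A : set R) (B : nat -> set R) : uniq s ->
  (forall i, i \in s -> (n <= i)%N) -> measurable A -> (forall i, measurable (B i)) ->
  P (partial_sum n @^-1` A `&` cyl s B) = P (partial_sum n @^-1` A) * P (cyl s B).
Proof.
elim: n s A B => [|n IH] s A B us sn mA mB.
  have [A0|A0] := pselect (A 0%R).
    have -> : partial_sum 0 @^-1` A = setT by apply/seteqP; split.
    by rewrite setTI probability_setT mul1e.
  have -> : partial_sum 0 @^-1` A = set0 by apply/seteqP; split.
  by rewrite set0I measure0 mul0e.
have ns : n \notin s by apply/negP => /sn; rewrite ltnn.
(* The cylinder on [s] with the constraint [C] on coordinate [n] added. *)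
pose B' C i := if i == n then C else B i.
have mB' C : measurable C -> forall i, measurable (B' C i) by move=> mC i;
  rewrite /B'; case: eqP.
have cylE C : cyl (n :: s) (B' C) = T n @^-1` C `&` cyl s B.
  rewrite /cyl bigcap_cons /B' eqxx; congr (_ `&` _).
  apply: eq_bigcapr => i /= si; case: eqP => // ini; by rewrite ini (negbTE ns) in si.
have cylP C : measurable C -> P (T n @^-1` C `&` cyl s B) = P (T n @^-1` C) * P (cyl
  s B).
  move=> mC; rewrite -cylE indep//=; [|by rewrite ns|exact: mB'].
  rewrite big_cons {1}/B' eqxx; congr (_ * _).
  rewrite /cyl indep//; rewrite big_seq [RHS]big_seq; apply: eq_bigr => i si.
  by rewrite /B'; case: eqP => // ini; rewrite ini (negbTE ns) in si.
have IHn A' C : measurable A' -> measurable C ->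
   P (partial_sum n @^-1` A' `&` (T n @^-1` C `&` cyl s B)) =
   P (partial_sum n @^-1` A') * (P (T n @^-1` C) * P (cyl s B)).
  move=> mA' mC; rewrite -cylE IH//;
    [by rewrite cylE cylP|by rewrite /= ns| |exact: mB'].
  by move=> i; rewrite inE => /predU1P[->//|/sn/ltnW].
have IHT A' C : measurable A' -> measurable C ->
   P (partial_sum n @^-1` A' `&` (T n @^-1` C `&` setT)) =
   P (partial_sum n @^-1` A') * (P (T n @^-1` C) * P setT).
  move=> mA' mC; rewrite setIT probability_setT mule1.
  have := IH [:: n] A' (fun=> C) isT _ mA' (fun=> mC).
  by rewrite /cyl bigcap_seq1; apply => i; rewrite inE => /eqP ->.
have mD : measurable ((fun x : R * R => x.1 + x.2)%R @^-1` A).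
  rewrite -[X in measurable X]setTI.
  have : measurable_fun [set: R * R] (fun x : R * R => x.1 + x.2)%R
    by exact: measurable_funD.
  exact.
(* The event that the sum lies in [A] is the preimage of a planar set under the pair of
   [partial_sum n] and [T n]. Its probability is computed with the cylinder and without it, and the
   two differ by the factor [P (cyl s B)]. *)
have := joint_law_product (cyl_measurable s mB) IHn mD.
have := joint_law_product measurableT IHT mD.
by rewrite setIT probability_setT mule1 => <-.
Qed.

Lemma partial_sum_law n (Z : set (R * R)) : measurable Z ->
  P ((fun w => (partial_sum n w, T n w)) @^-1` Z) =
  (distribution P (partial_sum n) \x distribution P (T n)) Z.
Proof.
move=> mZ; have := joint_law_product (X := partial_sum n) (Y := T n) measurableT _ mZ.
rewrite setIT probability_setT mule1; apply => A C mA mC.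
rewrite setIT mule1.
have := partial_sum_indep (n := n) (s := [:: n]) isT _ mA (fun=> mC).
by rewrite /cyl bigcap_seq1; apply => i; rewrite inE => /eqP ->.
Qed.

End independence.

(** * Distribution function and truncated excess of an exponential variable *)

Section exponential_law.
Local Open Scope ereal_scope.
Context d (Omega : measurableType d) (R : realType) (P : probability Omega R).
Let mu := @lebesgue_measure R.

Lemma exponential_cdf (r x : R) : (0 < r)%R ->
  exponential_prob r `]-oo, x] = (1 - expR (- r * Num.max x 0))%:E.
Proof.
move=> r0; have pdfE (A : set R) : exponential_prob r A =
    \int[mu]_(y in A `&` `[0%R, +oo[) (r * expR (- r * y))%:E.
  rewrite /exponential_prob /exponential_pdf integral_mkcondr.
  by apply: eq_integral => y _; rewrite !patchE; case: ifP.
have [x0|x0|->] := ltgtP x 0%R.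
- rewrite pdfE (_ : _ `&` _ = set0); last first.
    apply/seteqP; split=> // y []/=; rewrite !in_itv/= andbT => yx y0.
    by have := le_lt_trans (le_trans y0 yx) x0; rewrite ltxx.
  by rewrite integral_set0 mulr0 expR0 subrr.
- rewrite EFinB -(exponential_prob_itv0c r x0) pdfE [RHS]pdfE; congr (integral _ _ _).
  by apply/seteqP; split=> y []/=; rewrite !in_itv/= andbT;
    [move=> -> -> //|move=> /andP[_ ->] ->].
- rewrite pdfE (_ : _ `&` _ = [set 0%R]); last first.
    apply/seteqP; split=> y /=; rewrite !in_itv/= andbT.
      by move=> [y0 y1]; apply/eqP; rewrite eq_le y0.
    by move=> ->.
  by rewrite integral_set1 mulr0 expR0 subrr.
Qed.

Lemma exponential_cdf_open (r x : R) : (0 < r)%R ->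
  exponential_prob r `]-oo, x[ = (1 - expR (- r * Num.max x 0))%:E.
Proof.
move=> r0; rewrite -exponential_cdf// /exponential_prob integral_itv_bndo_bndc//.
by apply/measurable_EFinP/measurable_funTS; exact: measurable_exponential_pdf.
Qed.

Lemma integral_one_minus_expR (r c : R) : (0 < r)%R -> (0 < c)%R ->
  \int[mu]_(s in `[0%R, c]) (1 - expR (- r * (c - s)))%:E =
  (c - r^-1 * (1 - expR (- r * c)))%:E.
Proof.
move=> r0 c0.
pose F s : R := (s - r^-1 * expR (- r * (c - s)))%R.
have dF (x : R) : is_derive x 1%R F (1 - expR (- r * (c - x)))%R.
  rewrite /F; apply: is_derive_eq.
  by rewrite /GRing.scale/= add0r mul1r mulrN1 opprK mulrCA mulVf ?gt_eqF// mulr1.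
have cF : continuous F.
  by move=> x; apply: differentiable_continuous; apply/derivable1_diffP;
    exact: ex_derive.
rewrite (@continuous_FTC2 _ _ F)//.
- rewrite -EFinD; congr EFin; rewrite /F subrr subr0 mulr0 expR0; field;
  by rewrite gt_eqF.
- apply: continuous_subspaceT => x.
  have dG : derivable (fun s : R => (1 - expR (- r * (c - s)))%R : R) x 1
    by exact: ex_derive.
  by apply: differentiable_continuous; exact/derivable1_diffP.
- split=> [x _||].
  + exact: ex_derive.
  + by apply: cvg_at_right_filter; exact: cF.
  + by apply: cvg_at_left_filter; exact: cF.
- by move=> x _; rewrite derive1E derive_val.
Qed.

(** The expectation of [Y = (c - X)^+] is the integral of its tail [P(Y > s) = P(X < c - s)], which
    is explicit. *)
Lemma exponential_excess (X : {RV P >-> R}) (r c : R) : (0 < r)%R ->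
  exponentially_distributed r X ->
  \int[P]_w (Num.max (c - X w) 0)%:E + r^-1%:E * P (X @^-1` `]-oo, c]) =
  (Num.max c 0)%:E.
Proof.
move=> r0 lawX.
pose Y : {RV P >-> R} := (((cst c : {mfun Omega >-> R}) - (X : {mfun Omega >-> R}))%R
  \max cst 0%R : {mfun Omega >-> R}).
have YE w : Y w = Num.max (c - X w)%R 0%R by [].
have Y0 w : (0 <= Y w)%R by rewrite YE le_max lexx orbT.
have -> : \int[P]_w (Num.max (c - X w) 0)%:E = 'E_P[Y] by rewrite unlock.
rewrite (ge0_expectation_ccdf Y0).
have ccY s : (0 <= s)%R -> ccdf Y s = (1 - expR (- r * Num.max (c - s) 0))%:E.
  move=> s0; rewrite -exponential_cdf_open// -lawX//;
    rewrite /ccdf /distribution /pushforward; congr (P _).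
  have -> : Y @^-1` `]s, +oo[ = [set w | s < Num.max (c - X w) 0]%R.
    by apply/seteqP; split=> w; rewrite /= in_itv/= andbT.
  apply/seteqP; split=> w; rewrite /= in_itv/= lt_max.
    by case/orP; [lra|move/(le_lt_trans s0); rewrite ltxx].
  by move=> h; apply/orP; left; lra.
have -> : P (X @^-1` `]-oo, c]) = (1 - expR (- r * Num.max c 0))%:E.
  by rewrite -exponential_cdf// -lawX.
have [c0|c0] := leP c 0%R.
  rewrite mulr0 expR0 subrr mule0 adde0; apply: integral0_eq => s;
    rewrite /= in_itv/= andbT => s0.
  rewrite ccY// (_ : Num.max _ _ = 0%R) ?mulr0 ?expR0 ?subrr//.
  by apply/max_idPr; lra.
transitivity (\int[mu]_(s in `[0%R,
  c]) (1 - expR (- r * (c - s)))%:E + r^-1%:E * (1 - expR (- r * c))%:E); last first.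
  rewrite integral_one_minus_expR// -EFinM -EFinD; congr EFin; ring.
congr (_ + _).
(* The tail of [Y] vanishes beyond [c], so the integral over the half-line reduces to one over
   [[0, c]]. *)
have -> : `[0%R, c]%classic = `[0%R, +oo[%classic `&` `]-oo, c]%classic :> set R.
  by apply/seteqP; split=> s /=; rewrite !in_itv/= ?andbT; [move/andP|move=> [-> ->]].
rewrite integral_mkcondr; apply: eq_integral => s; rewrite inE/= in_itv/= andbT => s0.
rewrite ccY// patchE; case: ifPn; rewrite ?inE ?notin_setE/= in_itv/=.
  by move=> sc; congr (_ - expR (_ * _))%:E; apply/max_idPl; lra.
move=> /negP; rewrite -ltNge => sc;
  rewrite (_ : Num.max _ _ = 0%R) ?mulr0 ?expR0 ?subrr//.
by apply/max_idPr; lra.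
Qed.

End exponential_law.

(** * Expected number of jumps of the birth process *)

Section expected_count.
Local Open Scope ereal_scope.
Context d (Omega : measurableType d) (R : realType) (P : probability Omega R).
Variables (T : nat -> {RV P >-> R}) (rate : nat -> R).
Hypothesis rate_gt0 : forall n, (0 < rate n)%R.
Hypothesis indep : mutually_independent T.
Hypothesis lawT : forall n, exponentially_distributed (rate n) (T n).

Let S := partial_sum T.
(** Expected time left until [t] after the [n]-th jump; [F t n] is the probability that this jump
    has occurred by [t]. *)
Let h (t : R) n := \int[P]_w (Num.max (t - S n w) 0)%:E.
Let F (t : R) n := P (S n @^-1` `]-oo, t]).

Lemma excess_partial_sumS t n : h t n.+1 + (rate n)^-1%:E * F t n.+1 = h t n.
Proof.
pose r := rate n; have r0 : (0 <= r^-1)%R by rewrite invr_ge0 ltW// rate_gt0.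
(* Both terms of the left side as one nonnegative function of [(S n, T n)], so that Tonelli is
   applied once. *)
pose f (z : R * R) : \bar R :=
  (Num.max (t - z.1 - z.2) 0)%:E + r^-1%:E * (\1_([set z : R * R | z.1 + z.2 <= t]%R)
    z)%:E.
have mD : measurable [set z : R * R | z.1 + z.2 <= t]%R.
  have : measurable_fun [set: R * R] (fun x : R * R => x.1 + x.2)%R
    by exact: measurable_funD.
  move=> /(_ measurableT `]-oo, t]%classic (measurable_itv _)); rewrite setTI.
  by congr (measurable _); apply/seteqP; split=> z; rewrite /= in_itv.
have mInd : measurable_fun [set: R * R] (\1_([set z : R * R | z.1 + z.2 <= t]%R) : R
  * R -> R).
  exact: measurable_indic.
have mmax : measurable_fun [set: R * R] (fun z : R * R => Num.max (t - z.1 - z.2) 0)%R.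
  apply: measurable_maxr => //; apply: measurable_funB => //.
  by apply: measurable_funB.
have mf : measurable_fun [set: R * R] f.
  apply: emeasurable_funD; first exact/measurable_EFinP.
  apply: measurable_funeM; apply/measurable_EFinP; exact: measurable_indic.
have f0 z : 0 <= f z.
  by rewrite adde_ge0 ?mule_ge0 ?lee_fin// le_max lexx orbT.
pose ST w := (S n w, T n w).
have mST : measurable_fun [set: Omega] ST by exact: measurable_fun_pair.
transitivity (\int[P]_w f (ST w)).
  have mI : measurable_fun [set: Omega]
      (fun w => (\1_([set z : R * R | z.1 + z.2 <= t]%R) (ST w))%:E : \bar R).
    by apply/measurable_EFinP; exact: (measurableT_comp mInd mST).
  rewrite /f ge0_integralD//=.
  - congr (_ + _).
      by apply: eq_integral => w _ /=; rewrite opprD addrA.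
    rewrite ge0_integralZl//=.
    congr (_ * _).
    transitivity (\int[P]_w (\1_(S n.+1 @^-1` `]-oo, t]) w)%:E).
      by rewrite integral_indic// ?setIT// -[X in measurable X]setTI;
        exact: measurable_funP.
    apply: eq_integral => w _; rewrite !indicE.
    suff -> : (w \in S n.+1 @^-1` `]-oo,
      t]) = (ST w \in [set z | z.1 + z.2 <= t]%R) by [].
    by apply/idP/idP; rewrite !inE /=.
  - by move=> w _; rewrite lee_fin le_max lexx orbT.
  - by apply/measurable_EFinP; exact: (measurableT_comp mmax mST).
  - by move=> w _; rewrite mule_ge0 ?lee_fin.
  - exact: measurable_funeM.
transitivity (\int[distribution P (S n) \x distribution P (T n)]_z f z).
  rewrite -[LHS](@ge0_integral_pushforward _ _ _ _ _ ST mST P setT f)//.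
  apply: eq_measure_integral => Z mZ _; exact: partial_sum_law.
(* For a fixed value [x] of [S n] the inner integral is [exponential_excess] with [c = t - x]. *)
rewrite fubini_tonelli1//.
transitivity (\int[distribution P (S n)]_x (Num.max (t - x) 0)%:E).
  apply: eq_integral => x _; rewrite /fubini_F/=.
  rewrite ge0_integral_distribution//=; last first.
    exact: (measurableT_comp mf (measurable_pair1 x)).
  rewrite -(exponential_excess (X := T n) (t - x) (rate_gt0 n))//.
  have mI : measurable_fun [set: Omega]
      (fun w => (\1_([set z : R * R | z.1 + z.2 <= t]%R) (x, T n w))%:E : \bar R).
    apply/measurable_EFinP.
    have mIx : measurable_fun [set: R] (fun y =>
      \1_([set z : R * R | z.1 + z.2 <= t]%R) (x, y) : R).
      exact: (measurableT_comp mInd (measurable_pair1 x)).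
    have mT : measurable_fun [set: Omega] (T n) by exact: measurable_funP.
    exact: (measurableT_comp mIx mT).
  rewrite /f ge0_integralD//=.
  - congr (_ + _); rewrite ge0_integralZl//=.
    congr (_ * _).
    transitivity (\int[P]_w (\1_(T n @^-1` `]-oo, (t - x)%R]) w)%:E).
      apply: eq_integral => w _; rewrite !indicE.
      suff -> : ((x, T n w) \in [set z | z.1 + z.2 <= t]%R) = (w \in T n @^-1` `]-oo,
        (t - x)%R]) by [].
      by apply/idP/idP; rewrite !inE /= in_itv/=; lra.
    by rewrite integral_indic// ?setIT// -[X in measurable X]setTI;
      exact: measurable_funP.
  - by move=> w _; rewrite lee_fin le_max lexx orbT.
  - apply/measurable_EFinP; apply: measurable_maxr => //.
    by apply: measurable_funB.
  - by move=> w _; rewrite mule_ge0 ?lee_fin.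
  - exact: measurable_funeM.
rewrite ge0_integral_distribution//; last by move=> x; rewrite lee_fin le_max lexx orbT.
apply/measurable_EFinP; apply: measurable_maxr => //.
by apply: measurable_funB.
Qed.

Lemma exponential_ae_ge0 n : {ae P, forall w, (0 <= T n w)%R}.
Proof.
exists (T n @^-1` `]-oo, 0%R[); split.
- by rewrite -[X in measurable X]setTI; exact: measurable_funP.
- have -> : P (T n @^-1` `]-oo, 0%R[) = exponential_prob (rate n) `]-oo, 0%R[
  by rewrite -lawT.
  by rewrite exponential_cdf_open// maxxx mulr0 expR0 subrr.
- by move=> w /=; rewrite in_itv/= ltNge => /negP.
Qed.

Lemma partial_sum_ae_ge0 n : {ae P, forall w, (0 <= S n w)%R}.
Proof.
have : {ae P, forall w, forall i, (0 <= T i w)%R}.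
  by apply/ae_foralln => i; exact: exponential_ae_ge0.
by apply: filterS => w Tw; rewrite /S partial_sumE sumr_ge0.
Qed.

Let mS t n : measurable (S n @^-1` `]-oo, t]).
Proof. by rewrite -[X in measurable X]setTI; exact: measurable_funP. Qed.

(** Almost surely [S n >= 0], so the excess is at most [t] where [S n <= t] and 0 elsewhere. This
    makes [h] finite and, as [F t n] tends to 0, lets it vanish in the limit. *)
Lemma excess_partial_sum_le t n : (0 <= t)%R -> h t n <= t%:E * F t n.
Proof.
move=> t0.
have -> : t%:E * F t n = \int[P]_w (t%:E * (\1_(S n @^-1` `]-oo, t]) w)%:E).
  by rewrite ge0_integralZl//= ?integral_indic ?setIT//;
    exact/measurable_EFinP/measurable_indic.
apply: ae_ge0_le_integral => //.
- by move=> w _; rewrite lee_fin le_max lexx orbT.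
- apply/measurable_EFinP; apply: measurable_maxr => //.
  by apply: measurable_funB => //; exact: measurable_funP.
- by move=> w _; rewrite mule_ge0 ?lee_fin.
- by apply: measurable_funeM; exact/measurable_EFinP/measurable_indic.
- have := partial_sum_ae_ge0 n; apply: filterS => w Sw _.
  rewrite -EFinM lee_fin indicE; have [St|St] := leP (S n w) t.
    have -> : (w \in S n @^-1` `]-oo, t]) = true by apply: mem_set; rewrite /= in_itv.
    by rewrite mulr1 ge_max t0 andbT gerBl.
  have -> : (w \in S n @^-1` `]-oo, t]) = false.
    by apply: memNset; rewrite /= in_itv/= leNgt St.
  rewrite mulr0 ge_max lexx andbT.
  by rewrite subr_le0 ltW.
Qed.

Variable N : R -> {mfun Omega >-> nat}.
Hypothesis countN : {ae P, forall w, forall (t : R) (n : nat), (0 <= t)%R ->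
  (n <= N t w)%N = (\sum_(i < n) T i w <= t)%R}.

Let mN t n : measurable [set w | (n <= N t w)%N].
Proof.
have -> : [set w | (n <= N t w)%N] = N t @^-1` [set k | (n <= k)%N] by [].
by rewrite -[X in measurable X]setTI; exact: measurable_funP.
Qed.

Lemma count_tailE t n : (0 <= t)%R -> P [set w | (n <= N t w)%N] = F t n.
Proof.
move=> t0.
have PE A : measurable A -> P A = \int[P]_w (\1_A w)%:E.
  by move=> mA; rewrite integral_indic// setIT.
rewrite /F PE// [RHS]PE//; apply: ae_eq_integral => //.
- exact/measurable_EFinP/measurable_indic.
- exact/measurable_EFinP/measurable_indic.
- move: countN; apply: filterS => w /(_ t n t0) e _; congr EFin; rewrite !indicE.
  suff -> : (w \in [set w | (n <= N t w)%N]) = (w \in S n @^-1` `]-oo, t]) by [].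
  by apply/idP/idP; rewrite !inE /= in_itv/= /S partial_sumE e.
Qed.

(** No explosion: [N t w] is a natural number, so the events of at least [n] jumps decrease to the
    empty set. *)
Lemma count_tail_cvg0 t : (0 <= t)%R -> F t n @[n --> \oo] --> 0.
Proof.
move=> t0.
have := @nonincreasing_cvg_mu _ _ _ P (fun n => [set w | (n <= N t w)%N]).
have -> : \bigcap_n [set w | (n <= N t w)%N] = set0.
  by apply/seteqP; split=> // w /(_ (N t w).+1 I) /=; rewrite ltnn.
rewrite measure0; have -> : P \o (fun n => [set w | (n <= N t w)%N]) = F t.
  by apply/funext => n /=; exact: count_tailE.
apply => //; first by rewrite (le_lt_trans (probability_le1 _ _))// ltry.
by move=> m n mn; apply/subsetPset => w /=; exact: leq_trans.
Qed.

Lemma excess_partial_sum0 t : (0 <= t)%R -> h t 0%N = t%:E.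
Proof.
move=> t0; rewrite /h (eq_integral (cst t%:E)); last first.
  by move=> w _; rewrite /= subr0; congr EFin; apply/max_idPl.
by rewrite integral_cst//= probability_setT mule1.
Qed.

(** All rates after the first equal [rp], so the terms from the second on telescope to [rp * h t 1].
    The first term has its own rate and gives [h t 1] from [h t 0 = t]. *)
Lemma expected_count t (rp : R) : (0 <= t)%R -> (forall n, rate n.+1 = rp) ->
  series (fun n => fine (F t n.+1)) @ \oo -->
  (fine (F t 1%N) + rp * (t - (rate 0%N)^-1 * fine (F t 1%N)))%R.
Proof.
move=> t0 ratep.
have Ffin n : F t n \is a fin_num by exact: fin_num_measure.
have h0 n : 0 <= h t n by apply: integral_ge0 => w _; rewrite lee_fin le_max lexx orbT.
have hfin n : h t n \is a fin_num.
  rewrite ge0_fin_numE// (le_lt_trans (excess_partial_sum_le n t0))//.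
  by rewrite -(fineK (Ffin n)) -EFinM ltry.
pose f n := fine (F t n); pose k n := fine (h t n).
have kS n : (k n.+1 + (rate n)^-1 * f n.+1 = k n)%R.
  have := excess_partial_sumS t n.
  by rewrite -(fineK (hfin n)) -(fineK (hfin n.+1)) -(fineK (Ffin n.+1)) -EFinM
    -EFinD => -[].
have fS n : (f n.+2 = rp * (k n.+1 - k n.+2))%R.
  rewrite -(kS n.+1) ratep addrAC subrr add0r mulrA divff ?mul1r//.
  by rewrite -(ratep 0%N) gt_eqF.
have k0 : k @ \oo --> (0%R : R).
  have f0 : f @ \oo --> (0%R : R) by exact: fine_cvg (count_tail_cvg0 t0).
  have tf0 : (fun n => t * f n)%R @ \oo --> (0%R : R).
    by rewrite -[X in _ --> X](mulr0 t); apply: cvgM => //; exact: cvg_cst.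
  apply: (squeeze_cvgr _ (cvg_cst (0%R : R)) tf0); apply: nearW => n.
  rewrite fine_ge0//= -lee_fin EFinM fineK// fineK//.
  exact: excess_partial_sum_le.
have k1 : (k 1%N = t - (rate 0%N)^-1 * f 1%N)%R.
  have := kS 0%N; rewrite {2}/k excess_partial_sum0//= => <-; by rewrite addrK.
rewrite -cvg_shiftS/=.
have : (fun n => f 1%N + rp * (k 1%N - k n.+1))%R @ \oo
  --> (f 1%N + rp * (k 1%N - 0))%R.
  apply: cvgD; first exact: cvg_cst.
  apply: cvgM; first exact: cvg_cst.
  by apply: cvgB; [exact: cvg_cst|rewrite cvg_shiftS].
rewrite subr0 k1; apply: eq_cvg_seq => n; rewrite -k1.
elim: n => [|n IH]; first by rewrite subrr mulr0 addr0 /series/= big_nat1.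
by rewrite /series/= big_nat_recr//= -[X in (_ = X + _)%R]IH -/(f n.+2) fS; ring.
Qed.

End expected_count.

(** * Arrivals during a service *)

Section arrivals.
Context (R : realType) (b : R -> R).
Let mu := @lebesgue_measure R.
Let D : set R := `[0, +oo[%classic.
Hypothesis b_density : is_density b.

Let mD : measurable D. Proof. exact: measurable_itv. Qed.
Let D0 t : D t -> 0 <= t. Proof. by rewrite /D/= in_itv/= andbT. Qed.

Lemma density_integrable : mu.-integrable D (EFin \o b).
Proof.
have [mb b0 b1] := b_density; apply/integrableP; split; first exact/measurable_EFinP.
suff -> : (\int[mu]_(t in D) `|(EFin \o b) t| = 1)%E by rewrite ltry.
rewrite -b1; apply: eq_integral => t; rewrite inE => /D0 t0 /=.
by rewrite ger0_norm// b0.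
Qed.

Lemma density_mul_integrable (g : R -> R) : measurable_fun D g ->
  (forall t, 0 <= t -> 0 <= g t <= 1) -> mu.-integrable D (EFin \o (fun t =>
    g t * b t)).
Proof.
move=> mg g01; have [mb b0 b1] := b_density.
apply: le_integrable density_integrable => //.
  by apply/measurable_EFinP; exact: measurable_funM.
move=> t /D0 t0 /=; rewrite lee_fin normrM ler_piMl//.
by have /andP[g0 g1] := g01 _ t0; rewrite ger0_norm.
Qed.

Lemma density_Rintegral1 : \int[mu]_(t in D) b t = 1.
Proof. by rewrite /Rintegral; have [_ _ ->] := b_density. Qed.

Lemma lst_integrable s : 0 <= s -> mu.-integrable D (EFin \o (fun t =>
  expR (- s * t) * b t)).
Proof.
move=> s0; apply: density_mul_integrable => [|t t0].
  apply: measurable_funTS; apply: continuous_measurable_fun => t.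
  by apply: continuous_comp; [exact: mulrl_continuous|exact: continuous_expR].
by rewrite expR_ge0/= -expR0 ler_expR mulNr oppr_le0 mulr_ge0.
Qed.

Lemma lst_ge0_le1 s : 0 <= s -> 0 <= lst b s <= 1.
Proof.
move=> s0; have [mb b0 b1] := b_density; rewrite /lst; apply/andP; split.
  by apply: Rintegral_ge0 => t /D0 t0; rewrite mulr_ge0 ?expR_ge0 ?b0.
rewrite -density_Rintegral1; apply: le_Rintegral => //.
- exact: lst_integrable.
- exact: density_integrable.
- move=> t /D0 t0; rewrite ler_piMl ?b0//.
  by rewrite -expR0 ler_expR mulNr oppr_le0 mulr_ge0.
Qed.

Hypothesis b_mean : finite_mean b.

Lemma mean_integrable : mu.-integrable D (EFin \o (fun t => t * b t)).
Proof.
have [mb b0 b1] := b_density; apply/integrableP; split.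
  by apply/measurable_EFinP; apply: measurable_funM.
apply: le_lt_trans b_mean; rewrite le_eqVlt; apply/orP; left; apply/eqP.
apply: eq_integral => t; rewrite inE => /D0 t0 /=.
by rewrite ger0_norm// mulr_ge0// b0.
Qed.

Context d (Omega : measurableType d) (P : probability Omega R) (N : R ->
  {mfun Omega >-> nat}).
Variables (l lp : R).
Hypotheses (l_gt0 : 0 < l) (lp_gt0 : 0 < lp).
Hypothesis birth : pure_birth P (first_then l lp) N.

Let G n t := fine (P [set w | (n <= N t w)%N]).

Let mN n t : measurable [set w | (n <= N t w)%N].
Proof.
have -> : [set w | (n <= N t w)%N] = N t @^-1` [set k | (n <= k)%N] by [].
by rewrite -[X in measurable X]setTI; exact: measurable_funP.
Qed.

Let rate_gt0 n : 0 < first_then l lp n.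
Proof. by rewrite /first_then; case: ifP. Qed.

Let G01 n t : 0 <= G n t <= 1.
Proof.
rewrite fine_ge0//= -[1]/(fine 1%E) fine_le ?fin_num_measure//.
exact: probability_le1.
Qed.

(** On the half-line [G n] is the distribution function of a partial sum, hence monotone. *)
Let mG n : measurable_fun D (G n).
Proof.
have [T [indep lawT countN]] := birth.
pose S : {RV P >-> R} := partial_sum T n.
apply: (eq_measurable_fun (fine \o cdf S)).
  move=> t; rewrite inE => /D0 t0; rewrite /G /= (count_tailE countN)//.
apply: measurable_funTS; apply: nondecreasing_measurable => // x y xy.
by rewrite /= fine_le ?fin_num_measure// cdf_nondecreasing.
Qed.

Lemma count_series t : 0 <= t -> series (fun n => G n.+1 t) @ \oo -->
  (1 - expR (- l * t)) + lp * (t - l^-1 * (1 - expR (- l * t))).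
Proof.
move=> t0; have [T [indep lawT countN]] := birth.
have G1 : fine (P (partial_sum T 1 @^-1` `]-oo, t])) = 1 - expR (- l * t).
  have -> : partial_sum T 1 @^-1` `]-oo, t] = T 0%N @^-1` `]-oo, t].
    by apply/seteqP; split=> w; rewrite /= add0r.
  have -> : P (T 0%N @^-1` `]-oo, t]) = exponential_prob (first_then l lp 0) `]-oo,
    t] by rewrite -lawT.
  by rewrite exponential_cdf//= (max_idPl _).
have := expected_count rate_gt0 indep lawT countN t0 (fun n =>
  erefl (first_then l lp n.+1)).
rewrite G1; apply: eq_cvg_seq => k; apply: eq_bigr => n _.
by rewrite /G (count_tailE countN).
Qed.

Let te n := \int[mu]_(t in D) (G n t * b t).

Let Gb_int n : mu.-integrable D (EFin \o (fun t => G n t * b t)).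
Proof. by apply: density_mul_integrable => // t _; exact: G01. Qed.

Lemma arrivals_duringE n : arrivals_during P N b n = te n - te n.+1.
Proof.
rewrite /te -RintegralB// /arrivals_during; apply: eq_Rintegral => t _.
rewrite -mulrBl; congr (_ * _).
have -> : [set w | N t w = n] = [set w | (n <= N t w)%N] `\` [set w | (n.+1 <= N t
  w)%N].
  apply/seteqP; split=> w /=; first by move=> ->; rewrite ltnn.
  by move=> [h1 /negP]; rewrite -leqNgt => h2; apply/eqP; rewrite eqn_leq h1 h2.
rewrite measureD//; last by rewrite (le_lt_trans (probability_le1 _ _))// ltry.
rewrite setIidr ?fineB ?fin_num_measure//.
by move=> w /=; exact: ltnW.
Qed.

(** Provides the tail sequences on which the analysis of the chain rests. Their sum is the mean
    number of arrivals in a service, the mean count at time [t] integrated against [b]. *)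
Lemma arrivals_tail : exists te : nat -> R,
  [/\ te 0%N = 1, forall n, 0 <= te n, forall n, te n.+1 <= te n,
      arrivals_during P N b = (fun n => te n - te n.+1)
    & series (fun n => te n.+1) @ \oo -->
      (1 - lst b l) * (1 - lp / l) + lp * mean b].
Proof.
have [mb b0 b1] := b_density.
have mD' : measurable (D : set (measurableTypeR R)) by exact: measurable_itv.
exists te; split.
- rewrite -density_Rintegral1 /te; apply: eq_Rintegral => t _.
  rewrite /G (_ : [set w | _] = setT) ?probability_setT ?mul1r//.
  exact/seteqP.
- move=> n; apply: Rintegral_ge0 => t /D0 t0.
  by rewrite mulr_ge0 ?b0//; have /andP[] := G01 n t.
- move=> n; rewrite -subr_ge0 -arrivals_duringE.
  by apply: Rintegral_ge0 => t /D0 t0; rewrite mulr_ge0 ?b0// fine_ge0.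
- by apply/funext => n; exact: arrivals_duringE.
have teE n : (te n)%:E = (\int[mu]_(t in D) (G n t * b t)%:E)%E.
  by rewrite /te /Rintegral fineK//; exact: integral_fune_fin_num (Gb_int n).
have te0 n : 0 <= te n.+1.
  apply: Rintegral_ge0 => t /D0 t0.
  by rewrite mulr_ge0 ?b0//; have /andP[] := G01 n.+1 t.
apply: nneseries_cvg => //.
under eq_eseriesr do rewrite teE.
(* Sum and integral are exchanged by nonnegativity; [count_series] then evaluates the sum for each
   [t]. *)
rewrite -integral_nneseries//; last 2 first.
- by move=> n; exact: (measurable_int mu (Gb_int n.+1)).
- by move=> n t /D0 t0; rewrite lee_fin mulr_ge0 ?b0//; have /andP[] := G01 n.+1 t.
have Iint : mu.-integrable D (EFin \o (fun t =>
  (1 - lp / l) * (b t - expR (- l * t) * b t))).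
  have := integrableB mD' density_integrable (lst_integrable (ltW l_gt0)).
  by move=> /(integrableZl mD' (1 - lp / l)); apply: eq_integrable.
have Jint : mu.-integrable D (EFin \o (fun t => lp * (t * b t))).
  by have := integrableZl mD' lp mean_integrable; apply: eq_integrable.
have mE : (1 - lst b l) * (1 - lp / l) + lp * mean b =
    \int[mu]_(t in D) ((1 - lp / l) * (b t - expR (- l * t) * b t) + lp * (t * b t)).
  have i1 : mu.-integrable D (EFin \o (fun t => b t - expR (- l * t) * b t)).
    have := integrableB mD' density_integrable (lst_integrable (ltW l_gt0)).
    by apply: eq_integrable.
  have i2 := mean_integrable.
  rewrite RintegralD// !RintegralZl//.
  rewrite RintegralB//; [|exact: density_integrable|exact: lst_integrable (ltW l_gt0)].
  by rewrite density_Rintegral1 /lst /mean mulrC.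
rewrite mE /Rintegral fineK; last first.
  apply: integral_fune_fin_num => //.
  by have := integrableD mD' Iint Jint; apply: eq_integrable.
apply: eq_integral => t; rewrite inE => /D0 t0.
have := cvgM (count_series t0) (cvg_cst (b t)) => /(_ _ _) hs.
have hs' : series (fun n => G n.+1 t * b t) @ \oo -->
    ((1 - expR (- l * t)) + lp * (t - l^-1 * (1 - expR (- l * t)))) * b t.
  move: hs; apply: eq_cvg_seq => n /=.
  by rewrite /series/= mulr_suml.
rewrite nneseries_limn; last by apply/cvg_ex; eexists; exact: hs'.
rewrite (cvg_lim (@Rhausdorff R) hs'); congr EFin; ring.
Qed.

End arrivals.

(** * Condition (S) as a bound on the mean jump, and the theorem *)

Lemma stability_condE (R : realFieldType) (al bb Be Br le lep lr lrp : R) :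
  0 <= al <= 1 -> 0 < le -> 0 < lep -> 0 < lr -> 0 < lrp ->
  (bb < al * (lrp + (lr - lrp) * Br) / (lr * (lep + (lrp - lep) * al))
         - (1 - al) * (le - lep) * (1 - Be) / (le * (lep + (lrp - lep) * al))) =
  ((1 - al) * (1 + ((1 - Be) * (1 - lep / le) + lep * bb)) +
    al * ((1 - Br) * (1 - lrp / lr) + lrp * bb) < 1).
Proof.
move=> /andP[a0 a1] le0 lep0 lr0 lrp0.
have D0 : 0 < lep + (lrp - lep) * al.
  have -> : lep + (lrp - lep) * al = (1 - al) * lep + al * lrp by ring.
  (* In this convex combination the strictly positive summand is [lep] when [al = 0], and [al * lrp]
     otherwise. *)
  have [->|an0] := eqVneq al 0; first by rewrite subr0 mul1r mul0r addr0.
  rewrite ltr_wpDl ?mulr_gt0// ?mulr_ge0 ?subr_ge0// ?ltW//.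
  by rewrite lt_neqAle eq_sym an0.
(* The gap in (S) is the gap [1 - kappa] divided by the positive coefficient of [bb] in [kappa]. *)
rewrite -subr_gt0 -[RHS]subr_gt0 -[RHS](pmulr_lgt0 _ (x := (lep + (lrp - lep) *
  al)^-1)) ?invr_gt0//.
congr (0 < _); field.
by rewrite !gt_eqF.
Qed.

(* [lm], [le], [lep], [lr], [lrp] are the arrival rates lambda^-, lambda^e,
   lambda_+^e, lambda^r, lambda_+^r; [Pe] and [Pr] are the laws under which
   the arrivals [N] during a type-e, resp. type-r, service are considered. *)
Theorem theorem3p2 (R : realType) (d : measure_display)
    (Omega : measurableType d) (Pe Pr : probability Omega R)
    (N : R -> {mfun Omega >-> nat})
    (a b : R -> R) (lm le lep lr lrp : R)
    (a_density : is_density a)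
    (b_density : is_density b) (b_mean : finite_mean b)
    (lm_gt0 : 0 < lm) (le_gt0 : 0 < le) (lep_gt0 : 0 < lep)
    (lr_gt0 : 0 < lr) (lrp_gt0 : 0 < lrp)
    (birth_e : pure_birth Pe (first_then le lep) N)
    (birth_r : pure_birth Pr (first_then lr lrp) N) :
  let alpha := lst a lm in
  let bbar := mean b in
  let beta_e := lst b le in
  let beta_r := lst b lr in
  let be := arrivals_during Pe N b in
  let br := arrivals_during Pr N b in
  let Ae := pgf be in
  let Ar := pgf br in
  let p := orbit_chain alpha be br in
  let condS :=
    bbar < alpha * (lrp + (lr - lrp) * beta_r)
             / (lr * (lep + (lrp - lep) * alpha))
           - (1 - alpha) * (le - lep) * (1 - beta_e)
             / (le * (lep + (lrp - lep) * alpha)) in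
  (condS ->
    exists pi : nat -> R,
      [/\ stationary_distribution p pi,
          forall pi', stationary_distribution p pi' -> pi' = pi,
          forall z : Cplx R, `|z| <= 1 ->
            ratio_value
              (fun w => (pi 0%N)%:C * alpha%:C * (w * Ae w - Ar w))
              (fun w => alpha%:C * (w * Ae w - Ar w) + w * (1 - Ae w))
              z (pgf pi z)
        & pi 0%N =
            (le * alpha * (lrp * (1 - lr * bbar) + beta_r * (lr - lrp))
             - lr * (1 - alpha)
               * (lep * le * bbar + (1 - beta_e) * (le - lep)))
            / (alpha
               * (le * (lrp * (1 - lr * bbar) + beta_r * (lr - lrp))
                  + lr * (lep * le * bbar + (1 - beta_e) * (le - lep))))])
  /\ (ergodic p -> condS).
Proof.
move=> alpha bbar beta_e beta_r be br Ae Ar p condS.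
have alpha01 : 0 <= alpha <= 1 by exact: lst_ge0_le1 (ltW lm_gt0).
have [te [te0 te_ge0 te_le beE te_sum]] := arrivals_tail b_density b_mean le_gt0
  lep_gt0 birth_e.
have [tr [tr0 tr_ge0 tr_le brE tr_sum]] := arrivals_tail b_density b_mean lr_gt0
  lrp_gt0 birth_r.
(* The mean numbers of arrivals during services of type e and r. *)
set rho_e := (_ + _) in te_sum; set rho_r := (_ + _) in tr_sum.
have pE : p = orbit_chain alpha (fun n => te n - te n.+1) (fun n => tr n - tr n.+1).
  by rewrite /p /be /br beE brE.
pose kappa := (1 - alpha) * (1 + rho_e) + alpha * rho_r.
have condE : condS <-> kappa < 1 by rewrite /condS stability_condE.
split; last first.
  by rewrite condE pE => erg; exact: ergodic_kappa_lt1 te_sum tr_sum erg.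
move=> /condE kappa1.
have rho_e0 : 0 <= rho_e.
  by rewrite (le_trans _ (nonneg_series_le 0 _ te_sum))// /series/= big_geq.
have [pi st] : exists pi, stationary_distribution p pi.
  by rewrite pE; apply: (stationary_exists (rho_e := rho_e) (rho_r := rho_r)).
have st' := st; rewrite pE in st'.
exists pi; split => //.
- move=> pi' sti; rewrite pE in sti.
  by apply: (stationary_unique (rho_e := rho_e) (rho_r := rho_r) (te := te) (tr :=
    tr) (alpha := alpha)).
- have [pi_ge0 pi_sum _] := st; move=> z z1.
  pose K (w : Cplx R) : Cplx R := alpha%:C * Ar w + (1 - alpha%:C) * (w * Ae w).
  have gE w : alpha%:C * (w * Ae w - Ar w) + w * (1 - Ae w) = w - K w.
    by rewrite /K; move: (Ae w) (Ar w) (alpha%:C) => x y t; ring.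
  apply: (ratio_value_pgf (z0 := 1)) => // [|w w1|w w1].
  + by apply: summable_nonneg_cvg (nneseries_cvg pi_ge0 pi_sum).
  + have := pgf_stationary alpha01 te0 tr0 te_ge0 tr_ge0 te_le tr_le te_sum tr_sum
    st' w1.
    rewrite -beE -brE -/Ae -/Ar -/(K w) gE => ->.
    by rewrite /K; move: (Ae w) (Ar w) (alpha%:C) ((pi 0%N)%:C) => x y t u; ring.
  + have := jump_pgf_fixpoint alpha01 te0 tr0 te_ge0 tr_ge0 te_sum tr_sum kappa1 w1.
    by rewrite -beE -brE -/Ae -/Ar -/(K w) gE.
- have D0 : 0 < 1 - kappa + rho_e by rewrite ltr_wpDr// subr_gt0.
  (* At [alpha = 0] one has [kappa = 1 + rho_e >= 1], against (S); the formula for [pi 0] divides by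
     [alpha]. *)
  have al0 : alpha != 0.
    apply/eqP => a0; move: kappa1; rewrite /kappa a0; lra.
  have m : pi 0%N * (1 - kappa + rho_e) = 1 - kappa.
    have : (1 - kappa) * (1 - pi 0%N) = pi 0%N * rho_e.
      exact: (stationary_mass alpha01 te0 tr0 te_ge0 tr_ge0 te_le tr_le te_sum tr_sum
        st').
    by lra.
  (* The stated denominator and numerator are [le * lr] times [1 - kappa + rho_e] and [1 - kappa],
     so their ratio is the solution of [m]. *)
  have QE : alpha * (le * (lrp * (1 - lr * bbar) + beta_r * (lr - lrp))
                  + lr * (lep * le * bbar + (1 - beta_e) * (le - lep))) = (le * lr) *
                    (1 - kappa + rho_e).
    rewrite /kappa /rho_e /rho_r -/beta_e -/beta_r -/bbar; field.
    by rewrite !gt_eqF.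
  have NE : le * alpha * (lrp * (1 - lr * bbar) + beta_r * (lr - lrp))
             - lr * (1 - alpha)
               * (lep * le * bbar + (1 - beta_e) * (le - lep)) = (le * lr) * (1 -
                 kappa).
    rewrite /kappa /rho_e /rho_r -/beta_e -/beta_r -/bbar; field.
    by rewrite !gt_eqF.
  rewrite QE NE; apply: (canRL (mulfK _)); last by rewrite mulrCA m.
  by rewrite mulf_neq0 ?gt_eqF ?mulr_gt0.
Qed.
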